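(* Let $n$ be a positive integer and let $G_n$ denote either of the (equal) series $$\sum_{m,u_i,v_i\ge0}P_n(m;u;v)\,q^m\prod_{i=0}^{n-1}a_i^{u_i-v_i}\quad\text{or}\quad\sum_{m,u_i,v_i\ge0}F_n(m;u;v)\,q^m\prod_{i=0}^{n-1}a_i^{u_i-v_i}.$$ Then $$G_n=\frac{1}{(q;q)_\infty^n}\sum_{\substack{s_1,\dots,s_{n-1}\in\mathbb{Z}\\ s_n=0}}a_0^{-s_1}\prod_{i=1}^{n-1}a_i^{s_i-s_{i+1}}q^{s_i(s_i-s_{i+1})}$$ and $$G_n=\frac{1}{(q;q)_\infty}\left(\prod_{i=1}^{n-1}\frac{(q^{i(i+1)};q^{i(i+1)})_\infty}{(q;q)_\infty}\right)\sum_{\substack{r_1,\dots,r_{n-1}:\,0\le r_j\le j-1\\ r_n=0}}\prod_{i=1}^{n-1}a_i^{r_i-r_{i+1}}q^{r_i(r_i-r_{i+1})}\Big(-\Big(\prod_{\ell=0}^{i-1}a_ia_\ell^{-1}\Big)q^{\frac{i(i+1)}{2}+(i+1)r_i-ir_{i+1}};q^{i(i+1)}\Big)_\infty\Big(-\Big(\prod_{\ell=0}^{i-1}a_\ell a_i^{-1}\Big)q^{\frac{i(i+1)}{2}-(i+1)r_i+ir_{i+1}};q^{i(i+1)}\Big)_\infty.$$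
   Context: $(a;q)_\infty=\prod_{j\ge0}(1-aq^j)$. Colours are symbols $a_ib_k$, $0\le i,k\le n-1$, the colour $a_ib_k$ containing symbol $a_i$ once and $b_k$ once. With $\chi(P)\in\{0,1\}$ the truth value of $P$, $\Delta(a_ib_k,a_{i'}b_{k'})=\chi(i\ge i')-\chi(i=k=i')+\chi(k\le k')-\chi(k=i'=k')$. $\mathcal{P}_n$ is the set of coloured partitions $\lambda_1+\dots+\lambda_s$ (positive integer parts with colours $c(\lambda_j)$ among the $a_ib_k$) with $\lambda_j-\lambda_{j+1}\ge\Delta(c(\lambda_j),c(\lambda_{j+1}))$; $P_n(m;u;v)$ counts partitions of $m$ in $\mathcal{P}_n$ in whose colours each $a_i$ appears $u_i$ times and each $b_i$ appears $v_i$ times. An $n^2$-coloured Frobenius partition is an array $\begin{pmatrix}\lambda_1&\cdots&\lambda_s\\ \mu_1&\cdots&\mu_s\end{pmatrix}$ with $\lambda_1>\dots>\lambda_s$ non-negative integers coloured by symbols $a_i$, strictly decreasing for the order $0_{a_{n-1}}<\dots<0_{a_0}<1_{a_{n-1}}<\dots<1_{a_0}<\cdots$, and $\mu_1>\dots>\mu_s$ non-negative integers coloured by symbols $b_i$, strictly decreasing for the order $0_{b_0}<\dots<0_{b_{n-1}}<1_{b_0}<\dots$; its weight is $s+\sum\lambda_j+\sum\mu_j$; $F_n(m;u;v)$ counts those of weight $m$ with $u_i$ parts of $\lambda$ coloured $a_i$ and $v_i$ parts of $\mu$ coloured $b_i$ for each $i$. *)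

(* Defs.v *)
From HB Require Import structures.
From mathcomp Require Import all_boot all_order all_algebra finmap.
From mathcomp Require Import boolp classical_sets functions cardinality fsbigop.
From mathcomp Require Import zify.

Set Implicit Arguments.
Unset Strict Implicit.
Unset Printing Implicit Defensive.
Import Order.TTheory GRing.Theory Num.Theory.
Local Open Scope ring_scope.

(* Formal Laurent series in one variable q with coefficients in a commutative
   ring K.  They are needed because the product side of the theorem involves
   negative powers of q. *)
Record laurent (K : comNzRingType) := Laurent {
  lcoef : int -> K;
  lcoefP : exists N : int, forall k, k < N -> lcoef k = 0 }.

HB.instance Definition _ (K : comNzRingType) := gen_eqMixin (laurent K).
HB.instance Definition _ (K : comNzRingType) := gen_choiceMixin (laurent K).

Section LaurentRing.
Variable K : comNzRingType.
Implicit Types (f g h : laurent K) (k A B : int).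

Lemma laurentP f g : (forall k, lcoef f k = lcoef g k) -> f = g.
Proof.
case: f g => [f fP] [g gP] /= /funext fg.
by case: g / fg gP => gP; congr Laurent; apply: Prop_irrelevance.
Qed.

Definition lbounded A f := forall k, k < A -> lcoef f k = 0.

Lemma lboundedW A B f : B <= A -> lbounded A f -> lbounded B f.
Proof. by move=> BA fA k kB; apply: fA; lia. Qed.

Lemma lboundedE f : exists A, lbounded A f.
Proof. exact: lcoefP. Qed.

Fact lzero_subproof : exists N : int, forall k, k < N -> (0 : K) = 0.
Proof. by exists 0. Qed.
Definition lzero : laurent K := Laurent lzero_subproof.

Fact ladd_subproof f g :
  exists N : int, forall k, k < N -> lcoef f k + lcoef g k = 0.
Proof.
have [[A fA] [B gB]] := (lboundedE f, lboundedE g).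
by exists (Num.min A B) => k kN; rewrite fA ?gB ?addr0//; lia.
Qed.
Definition ladd f g : laurent K := Laurent (ladd_subproof f g).

Fact lopp_subproof f : exists N : int, forall k, k < N -> - lcoef f k = 0.
Proof. by have [A fA] := lboundedE f; exists A => k /fA ->; rewrite oppr0. Qed.
Definition lopp f : laurent K := Laurent (lopp_subproof f).

Fact lmono_subproof (c : K) (m : int) :
  exists N : int, forall k, k < N -> (if k == m then c else 0) = 0.
Proof. by exists m => k; rewrite lt_neqAle => /andP[/negPf->]. Qed.
(* c q^m *)
Definition lmono (c : K) (m : int) : laurent K := Laurent (lmono_subproof c m).

Lemma fsum_int_bounded (u : int -> K) (A : int) (j : nat) :
  (forall i : int, (i < A) || (A + j%:Z < i) -> u i = 0) ->
  \sum_(i \in [set: int]) u i = \sum_(i < j.+1) u (A + i%:Z).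
Proof.
move=> u0; pose r := [seq A + i%:Z | i <- iota 0 j.+1].
have r_uniq : uniq r by rewrite map_inj_uniq ?iota_uniq// => x y; lia.
rewrite (fsbigE r _ r_uniq)//.
  rewrite (eq_bigl xpredT) => [|i]; last by rewrite in_setT.
  by rewrite big_map -[iota 0 j.+1]/(index_iota 0 j.+1) big_mkord.
move=> i _ iN; apply: u0; apply: contraNT iN; rewrite negb_or -!leNgt => /andP[Ai iA].
by apply/mapP; exists `|i - A|%N; rewrite ?mem_iota; lia.
Qed.

Lemma lmulE_subproof A B f g (j : nat) : lbounded A f -> lbounded B g ->
  \sum_(i \in [set: int]) lcoef f i * lcoef g (A + B + j%:Z - i) =
  \sum_(i < j.+1) lcoef f (A + i%:Z) * lcoef g (B + (j - i)%N%:Z).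
Proof.
move=> fA gB; rewrite (@fsum_int_bounded _ A j) => [|i /orP[iA|iA]].
- by apply: eq_bigr => i _; congr (_ * lcoef g _); have := ltn_ord i; lia.
- by rewrite fA ?mul0r.
- by rewrite gB ?mulr0//; lia.
Qed.

Lemma lmul0_subproof A B f g k : lbounded A f -> lbounded B g -> k < A + B ->
  \sum_(i \in [set: int]) lcoef f i * lcoef g (k - i) = 0.
Proof.
move=> fA gB kAB; apply: fsbig1 => i _.
have [/fA->|iA] := ltP i A; first by rewrite mul0r.
by rewrite gB ?mulr0//; lia.
Qed.

Fact lmul_subproof f g : exists N : int, forall k, k < N ->
  \sum_(i \in [set: int]) lcoef f i * lcoef g (k - i) = 0.
Proof.
have [[A fA] [B gB]] := (lboundedE f, lboundedE g).
by exists (A + B) => k; apply: lmul0_subproof.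
Qed.
Definition lmul f g : laurent K := Laurent (lmul_subproof f g).

Lemma laddA : associative ladd.
Proof. by move=> f g h; apply: laurentP => k; exact: addrA. Qed.
Lemma laddC : commutative ladd.
Proof. by move=> f g; apply: laurentP => k; exact: addrC. Qed.
Lemma ladd0 : left_id lzero ladd.
Proof. by move=> f; apply: laurentP => k; exact: add0r. Qed.
Lemma laddN : left_inverse lzero lopp ladd.
Proof. by move=> f; apply: laurentP => k; exact: addNr. Qed.
HB.instance Definition _ :=
  GRing.isZmodule.Build (laurent K) laddA laddC ladd0 laddN.

Lemma lmul_bounded A B f g :
  lbounded A f -> lbounded B g -> lbounded (A + B) (lmul f g).
Proof. by move=> fA gB k; apply: lmul0_subproof. Qed.

Let ltrunc A j f : {poly K} := \poly_(i < j.+1) lcoef f (A + i%:Z).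

Let lmul_trunc A B f g (i j : nat) : lbounded A f -> lbounded B g ->
  (i <= j)%N ->
  lcoef (lmul f g) (A + B + i%:Z) = (ltrunc A j f * ltrunc B j g)`_i.
Proof.
move=> fA gB ij; rewrite [LHS](lmulE_subproof _ fA gB) coefM.
by apply: eq_bigr => l _; rewrite !coef_poly !ifT//; have := ltn_ord l; lia.
Qed.

Let lmul_trunc1 A B f g (j : nat) : lbounded A f -> lbounded B g ->
  lcoef (lmul f g) (A + B + j%:Z) = (ltrunc A j f * ltrunc B j g)`_j.
Proof. by move=> fA gB; apply: lmul_trunc. Qed.

Lemma lmulC : commutative lmul.
Proof.
move=> f g; apply: laurentP => k.
have [[A fA] [B gB]] := (lboundedE f, lboundedE g).
have [kAB|kAB] := ltP k (A + B).
  by rewrite (lmul_bounded fA gB)// (lmul_bounded gB fA)//; lia.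
have [j ->] : exists j : nat, k = A + B + j%:Z.
  by exists `|(k - (A + B))%R|%N; lia.
by rewrite (lmul_trunc1 _ fA gB) addrAC addrC addrA (lmul_trunc1 _ gB fA) mulrC.
Qed.

Lemma lmulA : associative lmul.
Proof.
move=> f g h; apply: laurentP => k.
have [[A fA] [B gB]] := (lboundedE f, lboundedE g).
have [C hC] := lboundedE h.
have fgAB := lmul_bounded fA gB; have ghBC := lmul_bounded gB hC.
have [kN|kN] := ltP k (A + B + C).
  by rewrite (lmul_bounded fgAB hC)// (lmul_bounded fA ghBC)//; lia.
have [j ->] : exists j : nat, k = A + B + C + j%:Z.
  by exists `|(k - (A + B + C))%R|%N; lia.
rewrite (lmul_trunc1 _ fgAB hC) -[A + B + C]addrA.
rewrite (lmul_trunc1 _ fA ghBC).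
transitivity (ltrunc A j f * ltrunc B j g * ltrunc C j h)`_j.
  rewrite -mulrA !coefM; apply: eq_bigr => i _; congr (_ * _).
  rewrite coef_poly ifT; last by have := ltn_ord i; lia.
  by apply: lmul_trunc => //; have := ltn_ord i; lia.
rewrite !coefM; apply: eq_bigr => i _; congr (_ * _).
rewrite coef_poly ifT; last by have := ltn_ord i; lia.
by rewrite (lmul_trunc (j := j) fA gB)//; have := ltn_ord i; lia.
Qed.

Lemma lcoef_mono_mul (c : K) (m : int) f k :
  lcoef (lmul (lmono c m) f) k = c * lcoef f (k - m).
Proof.
rewrite /= (@fsum_int_bounded _ m 0).
  by rewrite big_ord1 addr0 eqxx.
by move=> i im; rewrite ifF ?mul0r//; lia.
Qed.

Lemma lmul1 : left_id (lmono 1 0) lmul.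
Proof.
by move=> f; apply: laurentP => k; rewrite lcoef_mono_mul mul1r subr0.
Qed.

Lemma lmulDl : left_distributive lmul ladd.
Proof.
move=> f g h; apply: laurentP => k.
have [[A' fA'] [B' gB']] := (lboundedE f, lboundedE g).
pose A := Num.min A' B'.
have [fA gA] : lbounded A f /\ lbounded A g.
  by split; [apply: lboundedW fA' | apply: lboundedW gB']; rewrite /A; lia.
have fgA : lbounded A (ladd f g) by move=> i iA /=; rewrite fA// gA// addr0.
have [C hC] := lboundedE h.
have [kN|kN] := ltP k (A + C).
  rewrite [RHS]/= (lmul0_subproof fA hC kN) (lmul0_subproof gA hC kN) addr0.
  exact: (lmul_bounded fgA hC kN).
have [j ->] : exists j : nat, k = A + C + j%:Z.
  by exists `|(k - (A + C))%R|%N; lia.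
rewrite (lmul_trunc1 _ fgA hC).
rewrite [RHS](_ : _ = lcoef (lmul f h) (A + C + j%:Z) +
  lcoef (lmul g h) (A + C + j%:Z))//.
rewrite (lmul_trunc1 _ fA hC) (lmul_trunc1 _ gA hC) -coefD -mulrDl.
congr (nth 0 (polyseq (_ * _)) _); apply/polyP => i; rewrite coefD !coef_poly.
by case: ifP => //=; rewrite addr0.
Qed.

Lemma lone_neq0 : lmono 1 0 != 0.
Proof.
apply/eqP => /(congr1 (fun f : laurent K => lcoef f 0)) /= /eqP.
by rewrite oner_eq0.
Qed.

HB.instance Definition _ := GRing.Zmodule_isComNzRing.Build (laurent K)
  lmulA lmulC lmul1 lmulDl lone_neq0.

Definition lunit : {pred laurent K} := fun f => `[< exists g, g * f = 1 >].
Definition linv f : laurent K :=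
  if lunit f then xget 0 [set g | g * f = 1]%classic else f.

Lemma lmulVx : {in lunit, left_inverse 1 linv *%R}.
Proof.
move=> f fu; rewrite /linv ifT//; have /asboolP := fu.
exact: (@xgetPex _ 0 [set g | g * f = 1]%classic).
Qed.

Lemma lunitPl f g : g * f = 1 -> lunit f.
Proof. by move=> gf; apply/asboolP; exists g. Qed.

Lemma linv_out : {in [predC lunit], linv =1 id}.
Proof. by move=> f /negPf fu; rewrite /linv [lunit f]fu. Qed.

HB.instance Definition _ :=
  GRing.ComNzRing_hasMulInverse.Build (laurent K) lmulVx lunitPl linv_out.

End LaurentRing.

Notation "''q'" := (lmono 1 1) (at level 0) : ring_scope.
Definition lconst (K : comNzRingType) (c : K) : laurent K := lmono c 0.
Notation "c %:L" := (lconst c) (at level 1, left associativity, format "c %:L")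
  : ring_scope.

Section LaurentTheory.
Variable K : comNzRingType.
Implicit Types (f g l : laurent K) (c : K) (A B : int).

Lemma lcoefD f g k : lcoef (f + g) k = lcoef f k + lcoef g k.
Proof. by []. Qed.

Lemma lcoefN f k : lcoef (- f) k = - lcoef f k.
Proof. by []. Qed.

Lemma lcoefB f g k : lcoef (f - g) k = lcoef f k - lcoef g k.
Proof. by []. Qed.

Lemma lcoef0 k : lcoef (0 : laurent K) k = 0.
Proof. by []. Qed.

Lemma lcoef_sum I (r : seq I) (P : pred I) (F : I -> laurent K) k :
  lcoef (\sum_(i <- r | P i) F i) k = \sum_(i <- r | P i) lcoef (F i) k.
Proof. exact: (big_morph (fun f : laurent K => lcoef f k)). Qed.

Lemma lcoefMmono c m f k : lcoef (lmono c m * f) k = c * lcoef f (k - m).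
Proof. exact: lcoef_mono_mul. Qed.

Lemma lmonoM c d i j : lmono c i * lmono d j = lmono (c * d) (i + j).
Proof.
apply: laurentP => k; rewrite lcoefMmono /=.
rewrite -[k == _](_ : (k - i == j) = _); last by apply/eqP/eqP; lia.
by case: ifP; rewrite ?mulr0.
Qed.

Lemma lmono_prod I (r : seq I) (P : pred I) (c : I -> K) (e : I -> int) :
  \prod_(i <- r | P i) lmono (c i) (e i) =
  lmono (\prod_(i <- r | P i) c i) (\sum_(i <- r | P i) e i).
Proof.
elim: r => [|i r IH]; first by rewrite !big_nil.
by rewrite !big_cons; case: (P i); rewrite ?IH ?lmonoM.
Qed.

Lemma lmono_bounded c m : lbounded m (lmono c m).
Proof. by move=> k km /=; rewrite ifF//; lia. Qed.

Lemma lboundedM A B f g : lbounded A f -> lbounded B g -> lbounded (A + B) (f * g).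
Proof. exact: lmul_bounded. Qed.

Lemma lboundedD A f g : lbounded A f -> lbounded A g -> lbounded A (f + g).
Proof. by move=> fA gA k kA; rewrite lcoefD fA// gA// addr0. Qed.

Lemma lboundedN A f : lbounded A f -> lbounded A (- f).
Proof. by move=> fA k kA; rewrite lcoefN fA// oppr0. Qed.

Lemma lbounded1 : lbounded 0 (1 : laurent K).
Proof. exact: lmono_bounded. Qed.

Lemma lconst_is_zmod_morphism : zmod_morphism (@lconst K).
Proof.
move=> c d; apply: laurentP => k; rewrite lcoefB /=.
by case: ifP; rewrite ?subr0.
Qed.

Lemma lconst_is_monoid_morphism : monoid_morphism (@lconst K).
Proof. by split=> // c d; rewrite /lconst lmonoM addr0. Qed.

HB.instance Definition _ :=
  GRing.isZmodMorphism.Build K (laurent K) (@lconst K) lconst_is_zmod_morphism.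
HB.instance Definition _ :=
  GRing.isMonoidMorphism.Build K (laurent K) (@lconst K)
    lconst_is_monoid_morphism.

Lemma lq_unit : ('q : laurent K) \is a GRing.unit.
Proof.
apply/unitrPr; exists (lmono 1 (-1)).
by rewrite lmonoM mulr1 subrr.
Qed.

Lemma lqX (m : nat) : ('q : laurent K) ^+ m = lmono 1 m%:Z.
Proof.
elim: m => // m IH; rewrite exprS IH lmonoM mulr1; congr lmono; lia.
Qed.

Lemma lqXz (m : int) : ('q : laurent K) ^ m = lmono 1 m.
Proof.
case: m => m; first exact: lqX.
rewrite NegzE -exprnN lqX.
have mV : lmono (1 : K) m.+1%:Z * lmono 1 (- m.+1%:Z) = 1.
  by rewrite lmonoM mulr1 subrr.
have mU : lmono (1 : K) m.+1%:Z \is a GRing.unit.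
  by apply/unitrPr; exists (lmono 1 (- m.+1%:Z)).
by apply: (mulrI mU); rewrite mV mulrV.
Qed.

(* Convergence for the q-adic topology. *)
Definition lcvg (u : nat -> laurent K) l :=
  forall M : int, exists N : nat, forall m, (N <= m)%N ->
    forall k, k < M -> lcoef (u m) k = lcoef l k.

Definition llim (u : nat -> laurent K) : laurent K :=
  xget 0 [set l | lcvg u l]%classic.

Lemma lcvg_unique (u : nat -> laurent K) l l' : lcvg u l -> lcvg u l' -> l = l'.
Proof.
move=> ul ul'; apply: laurentP => k.
have [N uN] := ul (k + 1); have [N' uN'] := ul' (k + 1).
rewrite -(uN (N + N')%N) ?leq_addr ?(uN' (N + N')%N) ?leq_addl//; lia.
Qed.

Lemma lcvg_lim (u : nat -> laurent K) l : lcvg u l -> llim u = l.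
Proof.
by move=> ul; apply: xget_unique => // l' ul'; apply: lcvg_unique ul' ul.
Qed.

Lemma lcvg_cauchy (u : nat -> laurent K) :
  (forall M : int, exists N : nat, forall m, (N <= m)%N ->
     lbounded M (u m.+1 - u m)) -> lcvg u (llim u).
Proof.
move=> uC; suff [l ul] : exists l, lcvg u l by rewrite (lcvg_lim ul).
have {}uC (M : int) : {N : nat | forall m, (N <= m)%N ->
    forall k, k < M -> lcoef (u m) k = lcoef (u N) k}.
  apply: cid; have [N uN] := uC M; exists N => m Nm k kM.
  elim: m Nm => [|m IH]; first by rewrite leqn0 => /eqP->.
  rewrite leq_eqVlt => /predU1P[->//|]; rewrite ltnS => Nm.
  by rewrite -(IH Nm); apply/eqP; rewrite -subr_eq0 -lcoefB uN.
pose N M := sval (uC M).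
have NP M m k : (N M <= m)%N -> k < M -> lcoef (u m) k = lcoef (u (N M)) k.
  by move=> Nm kM; apply: (svalP (uC M)).
have NE M M' k : k < M -> k < M' -> lcoef (u (N M)) k = lcoef (u (N M')) k.
  move=> kM kM'; rewrite -(NP M (N M + N M')%N) ?leq_addr//.
  by rewrite (NP M')// leq_addl.
have lP : exists A : int, forall k, k < A -> lcoef (u (N (k + 1))) k = 0.
  have [A uA] := lboundedE (u (N 0)); exists (Num.min A 0) => k kA.
  by rewrite (NE _ 0) ?uA//; lia.
exists (Laurent lP) => M; exists (N M) => m Nm k kM /=.
by rewrite (NP M)//; apply: NE => //; lia.
Qed.

(* (x; p)_oo, meaningful as soon as p has only positive powers of q *)
Definition qpoch (x p : laurent K) : laurent K :=
  llim (fun N => \prod_(j < N) (1 - x * p ^+ j)).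

Lemma qpoch_cvg (x p : laurent K) : lbounded 1 p ->
  lcvg (fun N => \prod_(j < N) (1 - x * p ^+ j)) (qpoch x p).
Proof.
move=> p1; have pj j : lbounded j%:Z (p ^+ j).
  elim: j => [|j IH]; first exact: lbounded1.
  rewrite exprS; apply: lboundedW (lboundedM p1 IH); lia.
have [V xV] := lboundedE x.
pose u N := \prod_(j < N) (1 - x * p ^+ j).
have [W uW] := lboundedE (u `|V|%N).
have {}uW m : (`|V| <= m)%N -> lbounded W (u m).
  elim: m => [|m IH]; first by rewrite leqn0 => /eqP <-.
  rewrite leq_eqVlt => /predU1P[<-//|]; rewrite ltnS => Vm.
  have f0 : lbounded 0 (1 - x * p ^+ m).
    apply: lboundedD; first exact: lbounded1.
    apply: lboundedN.
    by apply: lboundedW (lboundedM xV (pj m)); lia.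
  by rewrite /u big_ord_recr -/(u m) /=; apply: lboundedW (lboundedM (IH Vm) f0); lia.
apply: lcvg_cauchy => M; exists (`|V| + `|(M - W - V)%R|)%N => m Nm.
rewrite big_ord_recr -/(u m) /= mulrBr mulr1 addrC addKr; apply: lboundedN.
apply: lboundedW (lboundedM (uW m _) (lboundedM xV (pj m))); lia.
Qed.

End LaurentTheory.

(* Unconditional sums for the q-adic topology. *)
Section LaurentSum.
Variables (K : comNzRingType) (T : choiceType).
Implicit Types (F : T -> laurent K) (S : laurent K).

Definition lhas_sum F S := forall M : int, exists A : {fset T},
  forall B : {fset T}, (A `<=` B)%fset ->
    forall k, k < M -> lcoef (\sum_(i <- B) F i) k = lcoef S k.

Definition lsum F : laurent K := xget 0 [set S | lhas_sum F S]%classic.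

Definition lsummable F := exists S, lhas_sum F S.

Lemma lhas_sum_unique F S S' : lhas_sum F S -> lhas_sum F S' -> S = S'.
Proof.
move=> FS FS'; apply: laurentP => k.
have [A FA] := FS (k + 1); have [A' FA'] := FS' (k + 1).
rewrite -(FA (A `|` A')%fset) ?fsubsetUl ?(FA' (A `|` A')%fset) ?fsubsetUr//; lia.
Qed.

Lemma lsumP F : lsummable F -> lhas_sum F (lsum F).
Proof. by move=> FS; apply: xgetPex. Qed.

Lemma lsumE F S : lhas_sum F S -> lsum F = S.
Proof.
by move=> FS; apply: (lhas_sum_unique _ FS); apply: lsumP; exists S.
Qed.

Lemma lsummableP F :
  (forall M : int, exists A : {fset T}, forall i, i \notin A -> lbounded M (F i)) ->
  lsummable F.
Proof.
move=> /(_ _)/cid FA0; pose A M := sval (FA0 M).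
have FA M i : i \notin A M -> lbounded M (F i) by exact: (svalP (FA0 M)).
have FB (k : int) (B C : {fset T}) : (forall i, i \notin B -> lcoef (F i) k = 0) ->
    (forall i, i \notin C -> lcoef (F i) k = 0) ->
    \sum_(i <- B) lcoef (F i) k = \sum_(i <- C) lcoef (F i) k.
  by move=> FB FC; rewrite -(fsbigTE B)// -(fsbigTE C).
have SP : exists N : int, forall k, k < N ->
    \sum_(i <- A (k + 1)) lcoef (F i) k = 0.
  have [N FN] : exists N : int, forall i, i \in enum_fset (A 0) -> lbounded N (F i).
    elim: (enum_fset (A 0)) => [|i s [N IH]]; first by exists 0.
    have [N' FN'] := lboundedE (F i); exists (Num.min N N') => j.
    rewrite in_cons => /predU1P[->|/IH]; first by apply: lboundedW FN'; lia.
    by apply: lboundedW; lia.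
  exists (Num.min N 0) => k kN; rewrite big1_fset// => i _ _.
  have [/FN|/FA] := boolP (i \in A 0); apply; lia.
exists (Laurent SP) => M; exists (A M) => B AB k kM; rewrite lcoef_sum /=.
apply: FB => i iN; last by apply: (FA _ _ iN); lia.
by apply: (FA M) => //; apply: contra iN; exact: (fsubsetP AB).
Qed.

End LaurentSum.

Section Counting.
Variable n : nat.

(* (i, k) stands for the colour a_i b_k *)
Definition colour := ('I_n * 'I_n)%type.

Definition Delta (c d : colour) : int :=
  (d.1 <= c.1)%N%:Z - [&& c.1 == c.2 & c.2 == d.1]%:Z +
  (c.2 <= d.2)%N%:Z - [&& c.2 == d.1 & d.1 == d.2]%:Z.

Definition in_Pn (l : seq (nat * colour)) : bool :=
  all (fun x => 0 < x.1)%N l &&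
  sorted (fun x y => Delta x.2 y.2 <= x.1%:Z - y.1%:Z) l.

Definition Pset (m : nat) (u v : 'I_n -> nat) : set (seq (nat * colour)) :=
  [set l | [/\ in_Pn l,
               (\sum_(x <- l) x.1 = m)%N,
               (forall i, count (fun x => x.2.1 == i) l = u i) &
               (forall i, count (fun x => x.2.2 == i) l = v i)]]%classic.

Definition Pcount m u v : nat := #|` fset_set (Pset m u v)|.

(* [gt_a x y] is x > y for 0_{a_(n-1)} < ... < 0_{a_0} < 1_{a_(n-1)} < ... *)
Definition gt_a (x y : nat * 'I_n) : bool :=
  (y.1 < x.1)%N || (y.1 == x.1) && (x.2 < y.2)%N.

(* [gt_b x y] is x > y for 0_{b_0} < ... < 0_{b_(n-1)} < 1_{b_0} < ... *)
Definition gt_b (x y : nat * 'I_n) : bool :=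
  (y.1 < x.1)%N || (y.1 == x.1) && (y.2 < x.2)%N.

Definition frobenius (p : seq (nat * 'I_n) * seq (nat * 'I_n)) : bool :=
  [&& size p.1 == size p.2, sorted gt_a p.1 & sorted gt_b p.2].

Definition Fset (m : nat) (u v : 'I_n -> nat) :
    set (seq (nat * 'I_n) * seq (nat * 'I_n)) :=
  [set p | [/\ frobenius p,
               (size p.1 + \sum_(x <- p.1) x.1 + \sum_(x <- p.2) x.1 = m)%N,
               (forall i, count (fun x => x.2 == i) p.1 = u i) &
               (forall i, count (fun x => x.2 == i) p.2 = v i)]]%classic.

Definition Fcount m u v : nat := #|` fset_set (Fset m u v)|.

Lemma finite_bounded_seq (T : finType) (m : nat) :
  finite_set [set l : seq (nat * T) |
    (size l <= m)%N /\ (\sum_(x <- l) x.1 <= m)%N]%classic.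
Proof.
pose g (x : 'I_m.+1 * T) : nat * T := (x.1 : nat, x.2).
apply: (sub_finite_set (B := [set map g l | l in [set: m.-bseq ('I_m.+1 * T)]]%classic)).
  move=> l [sl wl].
  have ls : (size (map (fun x : nat * T => (inord x.1 : 'I_m.+1, x.2)) l) <= m)%N.
    by rewrite size_map.
  exists (Bseq ls) => //=; rewrite -map_comp -[RHS]map_id.
  apply/eq_in_map => -[x c] xl /=; rewrite /g /= inordK// ltnS.
  by apply: leq_trans wl; rewrite (big_rem _ xl) /= leq_addr.
apply: finite_image; exact: finite_finset.
Qed.

Lemma Pset_finite m u v : finite_set (Pset m u v).
Proof.
apply: sub_finite_set (finite_bounded_seq colour m) => l /= [/andP[/allP l0 _] lm _ _].
split; last by rewrite lm.
rewrite -lm -sum1_size big_seq_cond [X in (_ <= X)%N]big_seq_cond.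
by apply: leq_sum => x /andP[/l0].
Qed.

Lemma Fset_finite m u v : finite_set (Fset m u v).
Proof.
have fin := finite_bounded_seq 'I_n m.
apply: sub_finite_set (finite_setX fin fin) => -[l r] /= [/and3P[/eqP lr _ _] lm _ _].
rewrite -lr; split; split=> /=; rewrite -lm.
- by rewrite -addnA leq_addr.
- by rewrite addnAC leq_addl.
- by rewrite -addnA leq_addr.
- by rewrite leq_addl.
Qed.

Lemma Pset_support m u v l : Pset m u v l -> forall i, (u i <= m)%N && (v i <= m)%N.
Proof.
move=> [/andP[/allP l0 _] lm lu lv] i.
have sl : (size l <= m)%N.
  rewrite -lm -sum1_size big_seq_cond [X in (_ <= X)%N]big_seq_cond.
  by apply: leq_sum => x /andP[/l0].
by rewrite -lu -lv !(leq_trans (count_size _ _) sl).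
Qed.

Lemma Fset_support m u v p : Fset m u v p -> forall i, (u i <= m)%N && (v i <= m)%N.
Proof.
move=> [/and3P[/eqP lr _ _] lm lu lv] i; have sl : (size p.1 <= m)%N by lia.
by rewrite -lu -lv !(leq_trans (count_size _ _))// -lr.
Qed.

End Counting.

Section Series.
Variables (K : comUnitRingType) (n : nat).

(* The a_i are taken to be arbitrary units of an arbitrary commutative ring K;
   formal variables are the case where K is the ring of Laurent polynomials (or
   of rational functions) in the a_i. *)
Definition colour_term (a : nat -> K)
    (cnt : nat -> ('I_n -> nat) -> ('I_n -> nat) -> nat)
    (x : nat * {ffun 'I_n -> nat} * {ffun 'I_n -> nat}) : laurent K :=
  let: (m, u, v) := x in
  (cnt m u v)%:R * 'q ^+ m * \prod_(i < n) (a i)%:L ^ ((u i)%:Z - (v i)%:Z).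

(* \sum_(m, u, v) cnt(m; u; v) q^m \prod_i a_i^(u_i - v_i) *)
Definition colour_series a cnt : laurent K := lsum (colour_term a cnt).

End Series.

(* s = (s_1, ..., s_(n-1)) is indexed from 0; [sub1 s j] is s_j for
   1 <= j <= n, with s_n = 0. *)
Definition sub1 n (s : 'I_n.-1 -> int) (j : nat) : int :=
  oapp s 0 (insub j.-1).


Section Summability.
Variables (K : comUnitRingType) (n : nat) (a : nat -> K).
Hypothesis a_unit : forall i, (i < n)%N -> a i \is a GRing.unit.

Lemma colour_term_summable (cnt : nat -> ('I_n -> nat) -> ('I_n -> nat) -> nat) :
  (forall m u v, cnt m u v != 0%N -> forall i, (u i <= m)%N && (v i <= m)%N) ->
  lsummable (colour_term a cnt).
Proof.
move=> cntP; apply: lsummableP => M.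
pose A := [set x : nat * {ffun 'I_n -> nat} * {ffun 'I_n -> nat} |
  [/\ (x.1.1 < `|M|)%N, forall i, (x.1.2 i <= `|M|)%N &
      forall i, (x.2 i <= `|M|)%N]]%classic.
have finA : finite_set A.
  pose I := 'I_(`|M|.+1); pose J := {ffun 'I_n -> I}.
  pose h (x : I * J * J) : nat * {ffun 'I_n -> nat} * {ffun 'I_n -> nat} :=
    (x.1.1 : nat, [ffun i => x.1.2 i : nat], [ffun i => x.2 i : nat]).
  apply: (sub_finite_set (B := [set h x | x in [set: I * J * J]]%classic)).
    move=> [[m u] v] [/= mM uM vM].
    exists (inord m, [ffun i => inord (u i)], [ffun i => inord (v i)]) => //.
    rewrite /h /=; congr (_, _, _); first by rewrite inordK//; lia.
      by apply/ffunP => i; rewrite !ffunE inordK// ltnS.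
    by apply/ffunP => i; rewrite !ffunE inordK// ltnS.
  by apply: finite_image; exact: finite_finset.
exists (fset_set A) => -[[m u] v]; rewrite in_fset_set// => /negP xA.
have [c0|/cntP uvm] := eqVneq (cnt m u v) 0%N.
  by rewrite /colour_term c0 mul0r mul0r.
have Mm : M <= m%:Z.
  rewrite leNgt; apply/negP => mM; apply: xA; rewrite inE /A /=.
  have {}mM : (m < `|M|)%N by lia.
  by split=> // i; have /andP[ui vi] := uvm i; apply: leq_trans (ltnW mM).
rewrite /colour_term.
have -> : \prod_(i < n) (a i)%:L ^ ((u i)%:Z - (v i)%:Z) =
    (\prod_(i < n) a i ^ ((u i)%:Z - (v i)%:Z))%:L.
  by rewrite rmorph_prod; apply: eq_bigr => i _; rewrite rmorphXz ?a_unit.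
rewrite lqX -[(cnt _ _ _)%:R](rmorph_nat (@lconst K)) !lmonoM addr0 add0r.
by apply: lboundedW (@lmono_bounded _ _ _).
Qed.

Lemma Pseries_summable : lsummable (colour_term a (@Pcount n)).
Proof.
apply: colour_term_summable => m u v; rewrite cardfs_eq0 => /fset0Pn[l].
by rewrite in_fset_set ?inE//; [exact: Pset_support | exact: Pset_finite].
Qed.

Lemma Fseries_summable : lsummable (colour_term a (@Fcount n)).
Proof.
apply: colour_term_summable => m u v; rewrite cardfs_eq0 => /fset0Pn[l].
by rewrite in_fset_set ?inE//; [exact: Fset_support | exact: Fset_finite].
Qed.

Lemma quad_bound (t : nat -> int) (j d : nat) :
  t j ^+ 2 - t (j + d)%N ^+ 2 + `|t j - t (j + d)%N| <=
  2 * \sum_(j <= i < j + d) t i * (t i - t i.+1).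
Proof.
elim: d => [|d IH]; first by rewrite addn0 big_geq//; lia.
rewrite addnS big_nat_recr ?leq_addr//= mulrDr.
set x := t (j + d)%N in IH *; set y := t (j + d).+1.
have sq (z : int) : `|z| <= z * z by nia.
have xy := sq (x - y).
have tri := ler_distD x (t j) y.
have -> : 2 * (x * (x - y)) = x ^+ 2 - y ^+ 2 + (x - y) * (x - y).
  by rewrite !expr2; lia.
move: IH xy tri; move: (\sum_(_ <= _ < _) _) (t j ^+ 2) (x ^+ 2) (y ^+ 2).
move: `|t j - x| `|t j - y| `|x - y| ((x - y) * (x - y)).
lia.
Qed.

Lemma quad_coord_bound (t : nat -> int) (N j : nat) : t N = 0 -> (0 < j <= N)%N ->
  `|t j| <= 2 * \sum_(1 <= i < N) t i * (t i - t i.+1).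
Proof.
move=> tN /andP[j0 jN]; rewrite (big_cat_nat j0 jN)/= mulrDr.
have := quad_bound t 1 j.-1; have := quad_bound t j (N - j).
rewrite subnKC// add1n prednK// tN expr0n subr0 subr0.
have := normr_ge0 (t 1%N - t j); have := sqr_ge0 (t 1%N).
move: (\sum_(_ <= _ < _) _) (\sum_(_ <= _ < _) _) (t j ^+ 2) (t 1%N ^+ 2).
move: `|t j| `|t 1%N - t j|; lia.
Qed.

Lemma theta_summable : (0 < n)%N -> lsummable (fun s : {ffun 'I_n.-1 -> int} =>
  (a 0%N)%:L ^ (- sub1 s 1%N) *
  \prod_(1 <= i < n) ((a i)%:L ^ (sub1 s i - sub1 s i.+1) *
                      'q ^ (sub1 s i * (sub1 s i - sub1 s i.+1)))).
Proof.
move=> n0; apply: lsummableP => M; pose B := absz (2 * M).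
pose A := [set s : {ffun 'I_n.-1 -> int} | forall i, `|s i| <= B%:Z]%classic.
have finA : finite_set A.
  pose h (x : {ffun 'I_n.-1 -> 'I_(B.*2.+1)}) : {ffun 'I_n.-1 -> int} :=
    [ffun i => (x i : nat)%:Z - B%:Z].
  apply: (sub_finite_set (B := [set h x | x in setT]%classic)).
    move=> s sA; exists [ffun i => inord (absz (s i + B%:Z))] => //.
    apply/ffunP => i; rewrite !ffunE; have := sA i.
    move: (s i) => z zB; rewrite inordK; first by lia.
    by rewrite -muln2; lia.
  by apply: finite_image; exact: finite_finset.
exists (fset_set A) => s; rewrite in_fset_set// => /negP sA.
pose E := \sum_(1 <= i < n) sub1 s i * (sub1 s i - sub1 s i.+1).
have ME : M <= E.
  rewrite leNgt; apply/negP => EM; apply: sA; rewrite inE => i /=.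
  have sn : sub1 s n = 0.
    by rewrite /sub1 insubF// ltnn.
  have := quad_coord_bound (j := i.+1) sn.
  have -> : sub1 s i.+1 = s i by rewrite /sub1 /= valK.
  have -> : (0 < i.+1 <= n)%N by have := ltn_ord i; lia.
  rewrite -/E /B => /(_ isT); move: (s i) E EM => z e EM; lia.
rewrite (eq_big_nat _ _ (F2 := fun i =>
    lmono (a i ^ (sub1 s i - sub1 s i.+1)) (sub1 s i * (sub1 s i - sub1 s i.+1)))).
  rewrite -rmorphXz ?a_unit// lmono_prod lmonoM add0r.
  by apply: (lboundedW ME); apply: lmono_bounded.
move=> i /andP[_ ltin].
by rewrite -rmorphXz ?a_unit// lqXz lmonoM mulr1 add0r.
Qed.

End Summability.

(* Main.v *)
Require Import Defs.
From mathcomp Require Import all_boot all_order all_algebra.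
From mathcomp Require Import finmap boolp classical_sets functions cardinality.
From mathcomp Require Import fsbigop zify ring.
Set Implicit Arguments.
Unset Strict Implicit.
Unset Printing Implicit Defensive.
Import Order.TTheory GRing.Theory Num.Theory.
Local Open Scope ring_scope.

(* Let R_s(c') be the generating function of the coloured partitions into s
   parts satisfying the gap conditions even when followed by a part 0 of colour
   c'.  Peeling off the smallest part expresses (1 - q^s) R_s through R_(s-1),
   for the colours a_i b_k with gaps Delta, for the upper rows and for the lower
   rows of Frobenius arrays alike.  Let x_r(i) and y_r(j) be the functions of
   the two rows.  When b_i = 1/a_i, the solution for Delta is
     R_N(a_i b_k) = \sum_r (q;q)_N/(q;q)_(N-r) q^((N-r)[i < j]) x_r(i) y_r(j),
   with j = k + 1 - [i = k].  At i = k = 0 the left side counts the partitions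
   with at most N parts, and for N -> oo the right side becomes
   \sum_r q^r x_r(n) y_r(0), which is the series of the Frobenius partitions.

   Next, x_r(n) is the coefficient of z^r in \prod_l (-z a_l; q)_oo and y_r(0)
   that in \prod_l (-z/a_l; q)_oo, so that Durfee's rectangle identity sums, for
   each colour, the pairs of exponents of given difference k_l.  What remains is
   a sum over the k in Z^n of sum 0, that is k_i = s_i - s_(i+1).  The product
   formula follows with s_j = r_j + j (x_j + ... + x_(n-1)), which diagonalizes
   the quadratic form, and Jacobi's triple product in each x_j. *)

(** * Unconditional sums of Laurent series *)

Section Bounded.
Variable K : comNzRingType.
Implicit Types (f g : laurent K) (M : int).

Lemma lbounded0 M : lbounded M (0 : laurent K).
Proof. by []. Qed.

Lemma lboundedB M f g : lbounded M f -> lbounded M g -> lbounded M (f - g).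
Proof. by move=> fM gM; apply: lboundedD => //; apply: lboundedN. Qed.

Lemma lbounded_sum M I (r : seq I) (P : pred I) (F : I -> laurent K) :
  (forall i, P i -> lbounded M (F i)) -> lbounded M (\sum_(i <- r | P i) F i).
Proof. by move=> FM; elim/big_ind: _ => // *; apply: lboundedD. Qed.

Lemma lbounded_prod I (r : seq I) (P : pred I) (F : I -> laurent K) (e : I -> int) :
  (forall i, P i -> lbounded (e i) (F i)) ->
  lbounded (\sum_(i <- r | P i) e i) (\prod_(i <- r | P i) F i).
Proof.
move=> FM; elim/big_ind2: _ => //; first exact: lbounded1.
by move=> *; apply: lboundedM.
Qed.

Lemma lboundedX M f j : lbounded M f -> lbounded (M * j%:Z) (f ^+ j).
Proof.
move=> fM; elim: j => [|j IH]; first by rewrite expr0; apply: lboundedW (@lbounded1 K); lia.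
rewrite exprS; apply: lboundedW (lboundedM fM IH); lia.
Qed.

Lemma lbounded_eq0 f : (forall M, lbounded M f) -> f = 0.
Proof. by move=> f0; apply: laurentP => k; rewrite (f0 (k + 1))//; lia. Qed.

Lemma lbounded_eq f g : (forall M, lbounded M (f - g)) -> f = g.
Proof. by move=> /lbounded_eq0/eqP; rewrite subr_eq0 => /eqP. Qed.

Lemma lbounded_trans M f g h : lbounded M (f - g) -> lbounded M (g - h) ->
  lbounded M (f - h).
Proof. by move=> fg gh; rewrite -[f](subrK g) -addrA; apply: lboundedD. Qed.

Lemma lcvgP (u : nat -> laurent K) l : lcvg u l <->
  forall M, exists N, forall m, (N <= m)%N -> lbounded M (l - u m).
Proof.
split=> ul M; have [N uN] := ul M; exists N => m Nm k kM; have := uN m Nm k kM.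
  by rewrite lcoefB => ->; rewrite subrr.
by rewrite lcoefB => /eqP; rewrite subr_eq0 => /eqP.
Qed.

End Bounded.

Section Small.
Variables (K : comNzRingType).

(** The terms tend to 0 q-adically. This suffices for summability, and it passes easily to
    subfamilies, fibres and products. *)
Definition lsmall (T : choiceType) (F : T -> laurent K) :=
  forall M, finite_set [set i | ~ lbounded M (F i)]%classic.

Variables (T U : choiceType).
Implicit Types (F G : T -> laurent K) (S c : laurent K) (M : int).

Lemma lsmallI F (A : int -> set T) : (forall M, finite_set (A M)) ->
  (forall M i, ~ A M i -> lbounded M (F i)) -> lsmall F.
Proof.
move=> finA FA M; apply: sub_finite_set (finA M) => i /= Fi.
by apply: contrapT => /FA.
Qed.

Lemma lsmallW F G : (forall M i, lbounded M (F i) -> lbounded M (G i)) ->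
  lsmall F -> lsmall G.
Proof.
move=> FG Fs; apply: (lsmallI Fs) => M i /= Fi.
by apply: FG; apply: contrapT => /Fi.
Qed.

Lemma lsmall_if F (b : pred T) : lsmall F -> lsmall (fun i => if b i then F i else 0).
Proof. by apply: lsmallW => M i FM; case: ifP. Qed.

Lemma lsmallZ c F : lsmall F -> lsmall (fun i => c * F i).
Proof.
have [V cV] := lboundedE c => Fs.
apply: (lsmallI (fun M => Fs (M - V))) => M i /= /contrapT FM.
by apply: lboundedW (lboundedM cV FM); lia.
Qed.

Lemma lsmall_comp (h : U -> T) F : injective h -> lsmall F -> lsmall (F \o h).
Proof.
move=> hI Fs M; apply: (finite_preimage (f := h) _ (Fs M)).
by move=> x y _ _; apply: hI.
Qed.

Lemma lsmall_fset F M : lsmall F ->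
  exists A : {fset T}, forall i, i \notin A -> lbounded M (F i).
Proof.
move=> Fs; exists (fset_set [set i | ~ lbounded M (F i)]%classic) => i.
by rewrite in_fset_set// notin_setE /= => /contrapT.
Qed.

Lemma lsmall_bounded F : lsmall F -> exists V : int, forall i, lbounded V (F i).
Proof.
move=> Fs; have [A FA] := lsmall_fset 0 Fs.
have [V FV] : exists V : int, forall i, i \in enum_fset A -> lbounded V (F i).
  elim: (enum_fset A) => [|i s [V IH]]; first by exists 0.
  have [V' FV'] := lboundedE (F i); exists (Num.min V V') => j.
  rewrite in_cons => /predU1P[->|/IH]; first by apply: lboundedW FV'; lia.
  by apply: lboundedW; lia.
exists (Num.min V 0) => i; have [/FV|/FA] := boolP (i \in A); apply: lboundedW; lia.
Qed.

Lemma lsmall_summable F : lsmall F -> lsummable F.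
Proof. by move=> Fs; apply: lsummableP => M; apply: lsmall_fset. Qed.

(** The sum agrees modulo q^M with a finite sum over a set containing [A], and the terms outside [A]
    have order at least M. *)
Lemma lsum_approx F (A : {fset T}) M : lsmall F ->
  (forall i, i \notin A -> lbounded M (F i)) ->
  lbounded M (lsum F - \sum_(i <- A) F i).
Proof.
move=> Fs FA; have [A' FA'] := lsumP (lsmall_summable Fs) M.
have {}FA' : lbounded M (\sum_(i <- (A `|` A')%fset) F i - lsum F).
  by move=> k kM; rewrite lcoefB FA' ?subrr// fsubsetUr.
rewrite -opprB; apply: lboundedN; rewrite -[\sum_(_ <- A) _]opprK -opprD.
apply: lboundedN; rewrite addrC.
rewrite -[X in X - _](subrK (\sum_(i <- (A `|` A')%fset) F i)) -addrA.
apply: lboundedD; first by rewrite -opprB; apply: lboundedN.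
rewrite (big_fsetID _ (mem A)) /= [X in X + _ - _](_ : _ = \sum_(i <- A) F i).
  rewrite [X in lbounded _ X]addrAC subrr add0r big_seq.
  by apply: lbounded_sum => i; rewrite !inE => /andP[_ /FA].
suff -> : [fset x in (A `|` A')%fset | x \in A]%fset = A by [].
by apply/fsetP => i; rewrite !inE; case: (i \in A) => //=; rewrite andbF.
Qed.

Lemma lsumI F S : (forall M, exists A : {fset T},
    (forall i, i \notin A -> lbounded M (F i)) /\
    lbounded M (S - \sum_(i <- A) F i)) -> lsum F = S.
Proof.
move=> FS; have Fs : lsmall F.
  apply: (@lsmallI F (fun M => [set` sval (cid (FS M))]%classic)) => M.
    exact: finite_fset.
  case: cid => A [/= FA _] i /negP; exact: FA.
apply: lbounded_eq => M; have [A [FA SA]] := FS M.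
apply: lbounded_trans (lsum_approx Fs FA) _.
by rewrite -opprB; apply: lboundedN.
Qed.

Lemma lsum_bounded F M : lsmall F -> (forall i, lbounded M (F i)) ->
  lbounded M (lsum F).
Proof.
move=> Fs FM; have := lsum_approx (A := fset0) Fs (fun i _ => FM i).
by rewrite big_seq_fset0 subr0.
Qed.

End Small.

Section SumTheory.
Variable K : comNzRingType.
Implicit Types (S c : laurent K) (M : int).

Lemma eq_lsum (T : choiceType) (F G : T -> laurent K) : F =1 G -> lsum F = lsum G.
Proof. by move=> /funext->. Qed.

Lemma eq_lsmall (T : choiceType) (F G : T -> laurent K) :
  F =1 G -> lsmall F -> lsmall G.
Proof. by move=> /funext->. Qed.

Lemma lsum_fset (T : choiceType) (F : T -> laurent K) (A : {fset T}) :
  (forall i, i \notin A -> F i = 0) -> lsum F = \sum_(i <- A) F i.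
Proof.
move=> FA; apply: lsumI => M; exists A; rewrite subrr; split=> // i /FA->.
exact: lbounded0.
Qed.

Lemma lsum0 (T : choiceType) : lsum (fun _ : T => 0 : laurent K) = 0.
Proof. by rewrite (lsum_fset (A := fset0))// big_seq_fset0. Qed.

Lemma lsum_fin (T : finType) (F : T -> laurent K) : lsum F = \sum_i F i.
Proof.
rewrite (lsum_fset (A := [fset i | i in T]%fset)) => [|i]; last by rewrite !inE.
by rewrite big_imfset//= big_enum.
Qed.

Lemma lsumZ (T : choiceType) c (F : T -> laurent K) : lsmall F ->
  lsum (fun i => c * F i) = c * lsum F.
Proof.
move=> Fs; apply: lsumI => M; have [V cV] := lboundedE c.
have [A FA] := lsmall_fset (M - V) Fs; exists A; split=> [i /FA FM|].
  by apply: lboundedW (lboundedM cV FM); lia.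
rewrite -mulr_sumr -mulrBr.
by apply: lboundedW (lboundedM cV (lsum_approx Fs FA)); lia.
Qed.

Lemma lsmallD (T : choiceType) (F G : T -> laurent K) :
  lsmall F -> lsmall G -> lsmall (fun i => F i + G i).
Proof.
move=> Fs Gs.
apply: (lsmallI (A := fun M => ([set i | ~ lbounded M (F i)] `|`
                                [set i | ~ lbounded M (G i)])%classic)).
  by move=> M; rewrite finite_setU; split; [exact: Fs | exact: Gs].
move=> M i /not_orP[/= /contrapT FM /contrapT GM]; exact: lboundedD.
Qed.

Lemma lsumD (T : choiceType) (F G : T -> laurent K) : lsmall F -> lsmall G ->
  lsum (fun i => F i + G i) = lsum F + lsum G.
Proof.
move=> Fs Gs; apply: lsumI => M.
have [A FA] := lsmall_fset M Fs; have [B GB] := lsmall_fset M Gs.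
have FAB i : i \notin (A `|` B)%fset -> lbounded M (F i).
  by rewrite inE negb_or => /andP[/FA].
have GAB i : i \notin (A `|` B)%fset -> lbounded M (G i).
  by rewrite inE negb_or => /andP[_ /GB].
exists (A `|` B)%fset; split=> [i iAB|].
  by apply: lboundedD; [exact: FAB | exact: GAB].
rewrite big_split /= opprD addrACA.
by apply: lboundedD; apply: lsum_approx.
Qed.

Lemma lsum_reindex (T U : choiceType) (h : T -> U) (G : U -> laurent K) :
  injective h -> lsmall (G \o h) -> (forall u, (forall t, h t != u) -> G u = 0) ->
  lsum G = lsum (G \o h).
Proof.
move=> hI Gs G0; apply: lsumI => M; have [A GA] := lsmall_fset M Gs.
exists (h @` A)%fset; split=> [u uA|].
  have [[t hu]|/forallNP hu] := pselect (exists t, h t = u); last first.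
    by rewrite G0// => t; apply/eqP; exact: hu.
  rewrite -hu; apply: GA; apply: contra uA => tA.
  by apply/imfsetP; exists t.
rewrite big_imfset /=; last by move=> x y _ _; exact: hI.
exact: lsum_approx.
Qed.

Lemma lsmall_reindex (T U : choiceType) (h : T -> U) (G : U -> laurent K) :
  lsmall (G \o h) -> (forall u, (forall t, h t != u) -> G u = 0) ->
  lsmall G.
Proof.
move=> Gs G0.
apply: (lsmallI (fun M => finite_image h (Gs M))) => M u.
move=> Mu; have [[t hu]|/forallNP hu] := pselect (exists t, h t = u); last first.
  by rewrite G0// => t; apply/eqP; exact: hu.
by apply: contrapT => uM; apply: Mu; exists t; rewrite /= ?hu.
Qed.

Section Fibre.
Variables (T U : choiceType) (h : T -> U) (F : T -> laurent K).
Hypothesis Fs : lsmall F.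

Let G u := lsum (fun t => if h t == u then F t else 0).

Let Gfib u (A : {fset T}) M : (forall i, i \notin A -> lbounded M (F i)) ->
  lbounded M (G u - \sum_(t <- A) if h t == u then F t else 0).
Proof.
move=> FA; apply: (lsum_approx (F := fun t => if h t == u then F t else 0)).
  exact: lsmall_if.
by move=> i /FA; case: ifP.
Qed.

Lemma lsmall_fibre : lsmall G.
Proof.
apply: (lsmallI (fun M => finite_image h (Fs M))) => M u uM.
apply: lsum_bounded => [|t]; first exact: lsmall_if.
have [tu|//] := eqVneq; apply: contrapT => FM; apply: uM.
by exists t.
Qed.

(** Modulo q^M both sides reduce to the same finite sum over [A], regrouped by the values of [h] on
    [A]. *)
Lemma lsum_fibre : lsum F = lsum G.
Proof.
apply/esym/lsumI => M; have [A FA] := lsmall_fset M Fs.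
exists (h @` A)%fset; split=> [u uA|].
  apply: lsum_bounded => [|t]; first exact: lsmall_if.
  have [tu|//] := eqVneq; apply: FA; apply: contra uA => tA.
  by apply/imfsetP; exists t.
apply: lbounded_trans (lsum_approx Fs FA) _.
have -> : \sum_(t <- A) F t =
    \sum_(u <- (h @` A)%fset) \sum_(t <- A) if h t == u then F t else 0.
  rewrite exchange_big /= !big_seq; apply: eq_bigr => t tA.
  rewrite (bigD1_seq (h t)) ?fset_uniq//=; last by apply/imfsetP; exists t.
  rewrite eqxx big1 ?addr0// => u; rewrite eq_sym => /negPf ->//.
rewrite -sumrB; apply: lbounded_sum => u _; rewrite -opprB; apply: lboundedN.
exact: Gfib.
Qed.

End Fibre.

Section Pair.
Variables (T U : choiceType).

Lemma lsmall_pairl (F : T * U -> laurent K) t :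
  lsmall F -> lsmall (fun u => F (t, u)).
Proof. by apply: lsmall_comp => x y []. Qed.

Let pair_fibre (F : T * U -> laurent K) : lsmall F ->
  forall t, lsum (fun p => if p.1 == t then F p else 0) = lsum (fun u => F (t, u)).
Proof.
move=> Fs t; rewrite (lsum_reindex (h := pair t)) /=.
- by apply: eq_lsum => u /=; rewrite eqxx.
- by move=> x y [].
- by under [_ \o _]funext => u do rewrite /= eqxx; exact: lsmall_pairl.
- by move=> [t' u] /(_ u)/=; have [->|//] := eqVneq t' t; rewrite eqxx.
Qed.

Lemma lsum_pair (F : T * U -> laurent K) : lsmall F ->
  lsum F = lsum (fun t => lsum (fun u => F (t, u))).
Proof.
move=> Fs; rewrite (lsum_fibre fst Fs); apply: eq_lsum; exact: pair_fibre.
Qed.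

Lemma lsmallM (F : T -> laurent K) (G : U -> laurent K) : lsmall F -> lsmall G ->
  lsmall (fun p => F p.1 * G p.2).
Proof.
move=> Fs Gs; have [V FV] := lsmall_bounded Fs; have [W GW] := lsmall_bounded Gs.
apply: (lsmallI (A := fun M => ([set i | ~ lbounded (M - W) (F i)] `*`
                                [set i | ~ lbounded (M - V) (G i)])%classic)).
  by move=> M; apply: finite_setX; [exact: Fs | exact: Gs].
move=> M [t u] /= /not_andP[] /= /contrapT.
  by move=> FM; apply: lboundedW (lboundedM FM (GW u)); lia.
by move=> GM; apply: lboundedW (lboundedM (FV t) GM); lia.
Qed.

Lemma lsumM (F : T -> laurent K) (G : U -> laurent K) : lsmall F -> lsmall G ->
  lsum F * lsum G = lsum (fun p => F p.1 * G p.2).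
Proof.
move=> Fs Gs; rewrite lsum_pair; last exact: lsmallM.
rewrite mulrC -lsumZ//; apply: eq_lsum => t /=.
by rewrite lsumZ// mulrC.
Qed.

End Pair.

Lemma lsum_nat_recl (F : nat -> laurent K) : lsmall F ->
  lsum F = F 0%N + lsum (fun m => F m.+1).
Proof.
move=> Fs; pose F0 m := if m == 0%N then F m else 0.
pose F1 m := if m != 0%N then F m else 0.
have F0s : lsmall F0 := lsmall_if (pred1 0%N) Fs.
have F1s : lsmall F1 := lsmall_if (predC1 0%N) Fs.
have -> : lsum F = lsum (fun m => F0 m + F1 m).
  by apply: eq_lsum => m; rewrite /F0 /F1; case: eqP; rewrite ?addr0 ?add0r.
rewrite lsumD//; congr (_ + _).
  rewrite (lsum_fset (A := [fset 0%N]%fset)) ?big_seq_fset1//.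
  by move=> i; rewrite inE /F0 => /negPf->.
rewrite (lsum_reindex (h := succn)); first by apply: eq_lsum => -[].
- by move=> x y [].
- by apply: (lsmall_comp (h := succn)) F1s => x y [].
- by case=> [|m] // /(_ m); rewrite eqxx.
Qed.

Lemma lsum_nat_split (F : nat -> laurent K) N : lsmall F ->
  lsum F = \sum_(m < N) F m + lsum (fun m => F (N + m)%N).
Proof.
move=> Fs; elim: N => [|N ->]; first by rewrite big_ord0 add0r.
rewrite lsum_nat_recl ?addn0 ?big_ord_recr /= ?addrA.
  by under [in RHS]eq_lsum do rewrite addSnnS.
by apply: (lsmall_comp (h := addn N)) => // x y; exact: addnI.
Qed.

Lemma lsmall_nat (F : nat -> laurent K) (V : int) :
  (forall m, lbounded (V + m%:Z) (F m)) -> lsmall F.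
Proof.
move=> Fm; apply: (lsmallI (A := fun M => `I_(`|M - V|%N))%classic) => [M|M m /=].
  exact: finite_II.
by move=> mM; apply: lboundedW (Fm m); lia.
Qed.

Lemma lsum_nat_approx (F : nat -> laurent K) N :
  (forall m, lbounded m%:Z (F m)) -> lbounded N%:Z (lsum F - \sum_(m < N) F m).
Proof.
move=> Fm; have Fs : lsmall F.
  by apply: (@lsmall_nat _ 0) => m; rewrite add0r; exact: Fm.
rewrite (lsum_nat_split N)// [X in lbounded _ X]addrC addKr.
apply: lsum_bounded => [|m]; last by apply: lboundedW (Fm _); lia.
by apply: (lsmall_comp (h := addn N)) => // x y; exact: addnI.
Qed.

(** Induction on the number of factors: a function on n + 1 indices is its value at [ord0] together
    with a function on n indices, so that [lsumM] applies. *)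
Lemma lprod_lsum (T : choiceType) n (F : 'I_n -> T -> laurent K) :
  (forall i, lsmall (F i)) ->
  lsmall (fun f : {ffun 'I_n -> T} => \prod_i F i (f i)) /\
  \prod_i lsum (F i) = lsum (fun f : {ffun 'I_n -> T} => \prod_i F i (f i)).
Proof.
elim: n F => [|n IH] F Fs.
  have Z (f g : {ffun 'I_0 -> T}) : f = g by apply/ffunP => -[].
  (* The unique function on the empty index set, which carries the empty product. *)
  pose f0 : {ffun 'I_0 -> T} := 
    [ffun i : 'I_0 => False_rect T (notF (ltn_ord i))].
  split.
    apply: (lsmallI (A := fun=> [set f0]%classic)) => // M f.
    by move=> /(_ (Z _ _)).
  rewrite (lsum_fset (A := [fset f0]%fset)) ?big_seq_fset1 ?big_ord0// => f.
  by rewrite inE (Z f f0) eqxx.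
have [sm e] := IH (fun i => F (lift ord0 i)) (fun i => Fs _).
pose h (p : T * {ffun 'I_n -> T}) : {ffun 'I_n.+1 -> T} :=
  [ffun i => if unlift ord0 i is Some j then p.2 j else p.1].
pose g (f : {ffun 'I_n.+1 -> T}) := (f ord0, [ffun j => f (lift ord0 j)]).
have hK : cancel h g.
  move=> [t f]; rewrite /g /h ffunE unlift_none; congr (_, _).
  by apply/ffunP => j; rewrite !ffunE liftK.
have Kh : cancel g h.
  move=> f; apply/ffunP => i; rewrite ffunE.
  by case: unliftP => [j ->|-> //]; rewrite ffunE.
pose G (f : {ffun 'I_n.+1 -> T}) := \prod_i F i (f i).
have Gh : G \o h = fun p => F ord0 p.1 * \prod_i F (lift ord0 i) (p.2 i).
  apply/funext => p; rewrite /G /= big_ord_recl ffunE unlift_none; congr (_ * _).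
  by apply: eq_bigr => i _; rewrite ffunE liftK.
have Gs : lsmall (G \o h) by rewrite Gh; exact: (lsmallM (Fs ord0) sm).
have G0 f : (forall t, h t != f) -> G f = 0.
  by move=> /(_ (g f)); rewrite Kh eqxx.
split; first exact: lsmall_reindex Gs G0.
rewrite (lsum_reindex (can_inj hK) Gs G0) Gh -(lsumM (Fs ord0) sm) -e.
by rewrite big_ord_recl.
Qed.

End SumTheory.

(** * Identities of Euler and Durfee *)

Lemma bin2_double m : ('C(m, 2) * 2 + m = m * m)%N.
Proof. by elim: m => // m IH; rewrite binS bin1; lia. Qed.

Section QSeries.
Variables (K : comNzRingType) (p : laurent K).
Hypothesis p1 : lbounded 1 p.
Implicit Types (x y : laurent K).

Lemma lboundedXn x m : lbounded 1 x -> lbounded m%:Z (x ^+ m).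
Proof. by move=> x1; apply: lboundedW (lboundedX (j := m) x1); lia. Qed.

Lemma lsmall_geometric x : lbounded 1 x -> lsmall (fun e => x ^+ e).
Proof.
by move=> x1; apply: (@lsmall_nat _ _ 0) => m; rewrite add0r; exact: lboundedXn.
Qed.

Lemma geometric_mul x : lbounded 1 x -> lsum (fun e => x ^+ e) * (1 - x) = 1.
Proof.
move=> x1; have Fs := lsmall_geometric x1.
rewrite mulrC mulrBl mul1r {1}lsum_nat_recl// expr0.
by under eq_lsum do rewrite exprS; rewrite lsumZ// addrK.
Qed.

Lemma lunit1B x : lbounded 1 x -> 1 - x \is a GRing.unit.
Proof.
by move=> x1; apply/unitrPr; exists (lsum (fun e => x ^+ e)); rewrite mulrC geometric_mul.
Qed.

Lemma lsum_geometric x : lbounded 1 x -> lsum (fun e => x ^+ e) = (1 - x)^-1.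
Proof.
by move=> x1; apply: (mulIr (lunit1B x1)); rewrite geometric_mul// mulVr// lunit1B.
Qed.

Lemma lbounded1BV x : lbounded 1 x -> lbounded 0 (1 - x)^-1.
Proof.
move=> x1; rewrite -lsum_geometric//; apply: lsum_bounded.
  exact: lsmall_geometric.
by move=> e; apply: lboundedW (lboundedXn (m := e) x1); lia.
Qed.

Lemma inv1BE x : lbounded 1 x -> (1 - x)^-1 = x * (1 - x)^-1 + 1.
Proof.
move=> /lunit1B xU; apply: (mulIr xU).
by rewrite mulrDl -mulrA !mulVr// mulr1 mul1r subrKC.
Qed.

Lemma lbounded1_unit x : lbounded 1 (1 - x) -> x \is a GRing.unit.
Proof. by move=> /lunit1B; rewrite subKr. Qed.

Lemma lbounded1_prod I (r : seq I) (F : I -> laurent K) (M : int) : 0 <= M ->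
  (forall i, lbounded M (1 - F i)) -> lbounded M (1 - \prod_(i <- r) F i).
Proof.
move=> M0 FM; elim: r => [|i r IH]; first by rewrite big_nil subrr.
have F0 : lbounded 0 (F i).
  rewrite -[F i](subKr 1); apply: lboundedB; first exact: lbounded1.
  exact: lboundedW (FM i).
rewrite big_cons; have -> : 1 - F i * \prod_(j <- r) F j =
  (1 - F i) + F i * (1 - \prod_(j <- r) F j) by ring.
by apply: lboundedD => //; apply: lboundedW (lboundedM F0 IH); lia.
Qed.

Lemma expS_bounded j : lbounded 1 (p ^+ j.+1).
Proof. by apply: lboundedW (lboundedXn p1); lia. Qed.

(** This is (p;p)_m. *)
Definition qfact m : laurent K := \prod_(j < m) (1 - p ^+ j.+1).

Lemma qfact0 : qfact 0 = 1.
Proof. by rewrite /qfact big_ord0. Qed.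

Lemma qfactS m : qfact m.+1 = qfact m * (1 - p ^+ m.+1).
Proof. by rewrite /qfact big_ord_recr. Qed.

Lemma qfact_1bounded m : lbounded 1 (1 - qfact m).
Proof. by apply: lbounded1_prod => // j; rewrite subKr; exact: expS_bounded. Qed.

Lemma qfact_unit m : qfact m \is a GRing.unit.
Proof. exact/lbounded1_unit/qfact_1bounded. Qed.

Lemma qfactV_bounded m : lbounded 0 (qfact m)^-1.
Proof.
by have := lbounded1BV (@qfact_1bounded m); rewrite subKr.
Qed.

Lemma qpoch_qfact_cvg : lcvg qfact (qpoch p p).
Proof.
have := qpoch_cvg p p1; congr lcvg; apply/funext => m; rewrite /qfact.
by apply: eq_bigr => j _; rewrite exprS.
Qed.

Lemma qpoch_1bounded : lbounded 1 (1 - qpoch p p).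
Proof.
have /lcvgP/(_ 1)[N /(_ N (leqnn N)) PN] := qpoch_qfact_cvg.
apply: lbounded_trans (@qfact_1bounded N) _.
by rewrite -opprB; apply: lboundedN.
Qed.

Lemma qpoch_unit : qpoch p p \is a GRing.unit.
Proof. exact/lbounded1_unit/qpoch_1bounded. Qed.

(** The m-th term of Euler's expansion of (-x;p)_oo. *)
Definition eulerc x m : laurent K := p ^+ 'C(m, 2) * x ^+ m / qfact m.

Lemma eulerc0 x : eulerc x 0 = 1.
Proof. by rewrite /eulerc qfact0 bin0n expr0 expr0 !mul1r invr1. Qed.

Lemma eulerc_bounded V x m : lbounded V x ->
  lbounded ('C(m, 2)%:Z + V * m%:Z) (eulerc x m).
Proof.
move=> xV.
have := lboundedM (lboundedM (lboundedXn (m := 'C(m, 2)) p1)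
  (lboundedX (j := m) xV)) (@qfactV_bounded m).
by apply: lboundedW; lia.
Qed.

Lemma lsmall_eulerc x : lsmall (eulerc x).
Proof.
(* The quadratic exponent beats [V * m]; the constant comes from completing the square. *)
have [V xV] := lboundedE x; apply: (@lsmall_nat _ _ (- (`|V| + 2) ^+ 2)) => m.
apply: lboundedW (eulerc_bounded (m := m) xV).
have := bin2_double m; move: 'C(m, 2) => C Cm; rewrite expr2.
have : C%:Z * 2 + m%:Z = m%:Z * m%:Z by lia.
have : (m%:Z - `|V| - 2) * (m%:Z - `|V| - 2) >= 0 by rewrite -expr2 sqr_ge0.
have : m%:Z * V >= - (m%:Z * `|V|).
  by rewrite -mulrN ler_wpM2l//; lia.
have : `|V| * `|V| >= 0 by rewrite -expr2 sqr_ge0.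
rewrite !mulrBr !mulrBl !mulrDr !mulrDl; have := normr_ge0 V.
rewrite [V * _]mulrC [ `|V| * m%:Z]mulrC; lia.
Qed.

(** This comes from 1/(1 - P) = P/(1 - P) + 1 with P = p^(m+1). Summed over m it is the functional
    equation E(x) = (1 + x) E(xp). *)
Lemma eulerc_rec x m :
  eulerc x m.+1 = eulerc (x * p) m.+1 + x * eulerc (x * p) m.
Proof.
have DE := inv1BE (expS_bounded m).
rewrite /eulerc qfactS invrM ?qfact_unit ?lunit1B//; last exact: expS_bounded.
rewrite binS bin1 exprD !exprMn {1}DE (exprS x m).
move: (1 - p ^+ m.+1)^-1 (qfact m)^-1 (p ^+ 'C(m, 2)) (p ^+ m) (x ^+ m) (p ^+ m.+1).
by move=> D Q c P X R; rewrite mulrDl mul1r mulrDr; congr (_ + _); ring.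
Qed.

Definition euler x := lsum (eulerc x).

Lemma euler_rec x : euler x = (1 + x) * euler (x * p).
Proof.
rewrite /euler lsum_nat_recl; last exact: lsmall_eulerc.
rewrite eulerc0; under eq_lsum do rewrite eulerc_rec.
have Fs := @lsmall_eulerc (x * p).
rewrite lsumD; first last.
- exact: lsmallZ.
- by apply: (lsmall_comp (h := succn)) => // i j [].
rewrite lsumZ// addrA mulrDl mul1r; congr (_ + _).
by rewrite [RHS]lsum_nat_recl// eulerc0.
Qed.

Lemma euler_prod x N :
  euler x = \prod_(j < N) (1 + x * p ^+ j) * euler (x * p ^+ N).
Proof.
elim: N => [|N IH]; first by rewrite big_ord0 mul1r expr0 mulr1.
by rewrite IH euler_rec big_ord_recr /= -!mulrA -exprSr.
Qed.

Lemma euler_1bounded (V : int) x : 0 <= V -> lbounded V x -> lbounded V (euler x - 1).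
Proof.
move=> V0 xV; have Fs := @lsmall_eulerc x.
rewrite /euler lsum_nat_recl// eulerc0 addrC addKr.
apply: lsum_bounded => [|m].
  by apply: (lsmall_comp (h := succn)) Fs => i j [].
apply: lboundedW (eulerc_bounded (m := m.+1) xV); nia.
Qed.

(** Iterating the functional equation N times leaves the factor [euler (x * p ^+ N)], which tends to
    1. *)
Lemma qpoch_euler x : qpoch (- x) p = euler x.
Proof.
apply: lbounded_eq => M.
pose u N := \prod_(j < N) (1 + x * p ^+ j).
have /lcvgP uC : lcvg u (qpoch (- x) p).
  have := qpoch_cvg (- x) p1; congr lcvg; apply/funext => N.
  by apply: eq_bigr => j _; rewrite mulNr opprK.
have [V PV] := lboundedE (qpoch (- x) p); have [W xW] := lboundedE x.
have [N1 uM] := uC M; have [N2 uV] := uC V.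
(* Large enough that the partial product agrees with its limit up to order M, that it has order at
   least V, and that the remaining Euler factor is 1 up to order M - V. *)
pose N := (N1 + N2 + `|W| + `|M - V|)%N.
apply: (lbounded_trans (g := u N)); first by apply: uM; rewrite /N; lia.
have uNV : lbounded V (u N).
  rewrite -[u N](subKr (qpoch (- x) p)); apply: lboundedB => //.
  by apply: uV; rewrite /N; lia.
have -> : u N - euler x = - (u N * (euler (x * p ^+ N) - 1)).
  by rewrite {1}(euler_prod x N) -/(u N); ring.
apply: lboundedN.
have xN := lboundedM xW (lboundedXn (m := N) p1).
have eN : lbounded (W + N%:Z) (euler (x * p ^+ N) - 1).
  by apply: euler_1bounded xN; rewrite /N; lia.
by apply: lboundedW (lboundedM uNV eN); rewrite /N; lia.
Qed.

(** This is (p;p)_N / (p;p)_(N-m), as a product that vanishes for m > N. *)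
Definition qff N m : laurent K := \prod_(j < m) (1 - p ^+ (N - j)).

Lemma qff0 N : qff N 0 = 1.
Proof. by rewrite /qff big_ord0. Qed.

Lemma qffS N m : qff N m.+1 = qff N m * (1 - p ^+ (N - m)).
Proof. by rewrite /qff big_ord_recr. Qed.

Lemma qffSS N m : qff N.+1 m.+1 = (1 - p ^+ N.+1) * qff N m.
Proof. by rewrite /qff big_ord_recl subn0. Qed.

Lemma qff_small N m : (N < m)%N -> qff N m = 0.
Proof.
elim: N m => [|N IH] [|m]// Nm; last by rewrite qffSS IH ?mulr0.
by rewrite /qff big_ord_recl subn0 expr0 subrr mul0r.
Qed.

Lemma qff_1bounded N m : (m <= N)%N -> lbounded (N - m).+1%:Z (1 - qff N m).
Proof.
move=> mN; rewrite /qff.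
have -> : \prod_(j < m) (1 - p ^+ (N - j)) = \prod_(j < m) (1 - p ^+ (N - m).+1 * p ^+ (m.-1 - j)).
  apply: eq_bigr => j _; rewrite -exprD; congr (1 - p ^+ _); have := ltn_ord j; lia.
apply: lbounded1_prod => // j; rewrite subKr -exprD.
apply: lboundedW (lboundedXn p1); lia.
Qed.

(** Gaussian binomial coefficients, given by Pascal's rule to avoid division. *)
Fixpoint qbin N m : laurent K :=
  match N, m with
  | _, 0 => 1
  | 0, _.+1 => 0
  | N'.+1, m'.+1 => qbin N' m + p ^+ (N' - m') * qbin N' m'
  end.

Lemma qbinn0 N : qbin N 0 = 1. Proof. by case: N. Qed.

(** Pascal's rule amounts to 1 - p^(N+1) = (1 - p^(N-m)) + p^(N-m) (1 - p^(m+1)). *)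
Lemma qbin_qff N m : qbin N m * qfact m = qff N m.
Proof.
elim: N m => [|N IH] [|m]; rewrite ?qbinn0 ?qfact0 ?qff0 ?mulr1//.
  by rewrite qff_small// mul0r.
rewrite /= mulrDl IH qfactS.
have -> : p ^+ (N - m) * qbin N m * (qfact m * (1 - p ^+ m.+1)) =
  p ^+ (N - m) * (qbin N m * qfact m) * (1 - p ^+ m.+1) by ring.
rewrite IH qffSS qffS.
have [mN|Nm] := leqP m N; last by rewrite qff_small// !(mul0r, mulr0) addr0.
have -> : N.+1 = (N - m + m.+1)%N by lia.
rewrite exprD; ring.
Qed.

Lemma qbin_small N m : (N < m)%N -> qbin N m = 0.
Proof.
by move=> Nm; apply: (mulIr (qfact_unit m)); rewrite qbin_qff mul0r qff_small.
Qed.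

(* q-Vandermonde, with one of its two parameters sent to infinity *)
Lemma durfee_finite N k :
  \sum_(m < N.+1) p ^+ (m * (m + k)) * qbin N m / qfact (m + k) =
  (qfact (N + k))^-1.
Proof.
elim: N k => [|N IH] k.
  by rewrite big_ord1 qbinn0 expr0 !mul1r.
pose t (m : nat) := p ^+ (m * (m + k)) * qbin N m / qfact (m + k).
pose t' (m : nat) := p ^+ (m * (m + k.+1)) * qbin N m / qfact (m + k.+1).
(* Pascal's rule splits the sum: the first part is the case (N, k), the second is p^(N+1+k) times
   the case (N, k+1). *)
transitivity (\sum_(m < N.+2) t m + \sum_(m < N.+1) p ^+ (N.+1 + k) * t' m).
  rewrite big_ord_recl [in RHS]big_ord_recl /= -addrA; congr (_ + _).
    by rewrite /t !qbinn0.
  rewrite -big_split /=; apply: eq_bigr => m _; rewrite /bump add1n.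
  rewrite /t /t' mulrDr mulrDl !addSnnS; congr (_ + _).
  have E : p ^+ (m.+1 * (m + k.+1)) * p ^+ (N - m) =
      p ^+ (N + k.+1) * p ^+ (m * (m + k.+1)).
    by rewrite -!exprD; congr (p ^+ _); have := ltn_ord m; nia.
  by rewrite !mulrA E.
rewrite big_ord_recr /= [t N.+1]/t qbin_small// mulr0 mul0r addr0 IH.
rewrite -mulr_sumr IH addnS addSn qfactS.
have := inv1BE (expS_bounded (N + k)).
rewrite invrM ?qfact_unit ?lunit1B//; last exact: expS_bounded.
by move: (p ^+ _) ((1 - _)^-1) ((qfact _)^-1) => P D Q DE; rewrite [in RHS]DE; ring.
Qed.

Lemma durfee_term_bounded k m :
  lbounded (m * (m + k))%N%:Z (p ^+ (m * (m + k)) / (qfact m * qfact (m + k))).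
Proof.
rewrite invrM ?qfact_unit//.
have := lboundedM (lboundedXn (m := m * (m + k)) p1)
  (lboundedM (@qfactV_bounded (m + k)) (@qfactV_bounded m)).
by apply: lboundedW; lia.
Qed.

Lemma lsmall_durfee k :
  lsmall (fun m => p ^+ (m * (m + k)) / (qfact m * qfact (m + k))).
Proof.
apply: (@lsmall_nat _ _ 0) => m; apply: lboundedW (@durfee_term_bounded k m); nia.
Qed.

(** Limit of [durfee_finite] for N -> oo: the m-th terms differ by the factor [qff N m], which is 1
    modulo q^(N-m+1). *)
Lemma durfee k :
  lsum (fun m => p ^+ (m * (m + k)) / (qfact m * qfact (m + k))) = (qpoch p p)^-1.
Proof.
set t := fun m : nat => _; set D := lsum t.
have tm m : lbounded m%:Z (t m).
  by apply: lboundedW (@durfee_term_bounded k m); nia.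
have DN N : lbounded N%:Z (D - (qfact (N + k))^-1).
  have := lsum_nat_approx (N := N.+1) tm; rewrite -/D => DN.
  apply: lbounded_trans; first by apply: lboundedW DN; lia.
  rewrite -durfee_finite -sumrB; apply: lbounded_sum => m _.
  have -> : t m - p ^+ (m * (m + k)) * qbin N m / qfact (m + k) =
    t m * (1 - qff N m).
    rewrite -qbin_qff mulrBr mulr1; congr (_ - _).
    rewrite /t invrM ?qfact_unit// !mulrA.
    rewrite -[LHS]mul1r -(mulVr (qfact_unit m)); ring.
  have mN : (m <= N)%N by have := ltn_ord m; lia.
  have := lboundedM (@durfee_term_bounded k m) (qff_1bounded mN).
  by apply: lboundedW; nia.
apply: (mulIr qpoch_unit); rewrite mulVr ?qpoch_unit//; apply: lbounded_eq => M.
have /lcvgP/(_ M)[N0 QN] := qpoch_qfact_cvg; pose N := (N0 + `|M|)%N.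
apply: (lbounded_trans (g := D * qfact (N + k))).
  rewrite -mulrBr; have D0 : lbounded 0 D.
    by apply: lsum_bounded (lsmall_durfee k) _ => m; apply: lboundedW (@tm m); lia.
  by apply: lboundedW (lboundedM D0 (QN _ _)); rewrite ?/N; lia.
have -> : D * qfact (N + k) - 1 = (D - (qfact (N + k))^-1) * qfact (N + k).
  by rewrite mulrBl mulVr// qfact_unit.
have Q0 : lbounded 0 (qfact (N + k)).
  rewrite -[qfact _](subKr 1); apply: lboundedB; first exact: lbounded1.
  by apply: lboundedW (qfact_1bounded _).
by apply: lboundedW (lboundedM (@DN N) Q0); rewrite /N; lia.
Qed.

(** As xy = p, the exponents combine through C(m+k,2) + C(m,2) + m = C(k,2) + m(m+k), and the sum
    over m becomes Durfee's. *)
Lemma euler_diag_nat x y k : x * y = p ->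
  lsum (fun m => eulerc x (m + k) * eulerc y m) =
  x ^+ k * p ^+ 'C(k, 2) / qpoch p p.
Proof.
move=> xy; rewrite -(durfee k) -lsumZ; last exact: lsmall_durfee.
apply: eq_lsum => m; rewrite /eulerc.
have -> : x ^+ (m + k) = x ^+ m * x ^+ k by rewrite exprD.
rewrite invrM ?qfact_unit//.
have bE : ('C(m + k, 2) + 'C(m, 2) + m = 'C(k, 2) + m * (m + k))%N.
  have := bin2_double m; have := bin2_double k; have := bin2_double (m + k).
  rewrite mulnDr !mulnDl [(k * m)%N]mulnC; lia.
have pE : p ^+ 'C(m + k, 2) * p ^+ 'C(m, 2) * (x ^+ m * y ^+ m) =
    p ^+ 'C(k, 2) * p ^+ (m * (m + k)).
  by rewrite -exprMn xy -!exprD bE.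
transitivity (p ^+ 'C(m + k, 2) * p ^+ 'C(m, 2) * (x ^+ m * y ^+ m) *
  (x ^+ k / qfact (m + k) / qfact m)); first by ring.
by rewrite pE; ring.
Qed.

End QSeries.

(** * Jacobi's triple product *)

(* tri x = x (x - 1) / 2 *)
Definition tri (x : int) : int :=
  match x with Posz k => 'C(k, 2)%:Z | Negz k => 'C(k.+2, 2)%:Z end.

Lemma tri_double x : tri x * 2 = x * (x - 1).
Proof.
case: x => k /=; have := bin2_double k; have := bin2_double k.+2; rewrite ?NegzE.
  by move=> _; move: 'C(k, 2) => C; rewrite mulrBr mulr1; lia.
by move=> + _; move: 'C(k.+2, 2) => C; rewrite mulrBr mulr1 mulrNN !mulSn !mulnS; lia.
Qed.

Section JacobiTriple.
Variables (K : comUnitRingType) (N : nat).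
Hypothesis N_gt0 : (0 < N)%N.
Let p : laurent K := 'q ^+ N.

Lemma qX_bounded : lbounded 1 ('q ^+ N : laurent K).
Proof. by rewrite lqX; apply: lboundedW (@lmono_bounded _ 1 N%:Z); lia. Qed.

Let p1 : lbounded 1 p := qX_bounded.

Lemma lmonoX (c : K) (e : int) m : lmono c e ^+ m = lmono (c ^+ m) (e * m%:Z).
Proof.
elim: m => [|m IH]; first by rewrite !expr0 mulr0.
by rewrite !exprS IH lmonoM; congr lmono; lia.
Qed.

(** With z = u q^e and p = q^N this is z^x p^(x(x-1)/2), the general term of a theta series. *)
Definition jterm (u : K) (e x : int) : laurent K :=
  lmono (u ^ x) (e * x + N%:Z * tri x).

Variables (u : K) (e : int).
Hypothesis u_unit : u \is a GRing.unit.

Let F (m : nat * nat) : laurent K :=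
  eulerc p (lmono u e) m.1 * eulerc p (lmono u^-1 (N%:Z - e)) m.2.

Let Fs : lsmall F.
Proof. by apply: lsmallM; apply: lsmall_eulerc. Qed.

Let xy : lmono u e * lmono u^-1 (N%:Z - e) = p.
Proof. by rewrite lmonoM mulrV// /p lqX; congr lmono; lia. Qed.

(** The fibre over x is a ray of pairs (m + k, m) or (m, m + k); the second case is the first with z
    and p/z exchanged. *)
Lemma euler_diag x :
  lsum (fun m => if m.1%:Z - m.2%:Z == x then F m else 0) =
  jterm u e x / qpoch p p.
Proof.
case: x => k.
  rewrite (lsum_reindex (h := fun m => (m + k, m)%N)).
  - rewrite -[jterm _ _ _](_ : lmono u e ^+ k * p ^+ 'C(k, 2) = _); last first.
      by rewrite /jterm /p lqX !lmonoX lmonoM expr1n mulr1.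
    rewrite -(euler_diag_nat p1 k xy); apply: eq_lsum => m /=.
    by rewrite ifT// PoszD addrC addrA addNr add0r.
  - by move=> m m' /(congr1 snd).
  - apply: (lsmall_comp (h := fun m => (m + k, m)%N)) => [m m' /(congr1 snd)//|].
    exact: lsmall_if.
  - move=> [m1 m2] /(_ m2)/=; case: eqP => [_ /negP[]//|ne _].
    case: ifP => [/eqP m12|_]; last by []; case: ne.
    by congr (_, _); lia.
rewrite (lsum_reindex (h := fun m => (m, m + k.+1)%N)).
- rewrite -[jterm _ _ _](_ : lmono u^-1 (N%:Z - e) ^+ k.+1 * p ^+ 'C(k.+1, 2) = _); last first.
    rewrite /jterm /p lqX !lmonoX lmonoM expr1n mulr1 exprVn; congr lmono.
    rewrite /= [in RHS]binS bin1 NegzE PoszD; ring.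
  have yx := xy; rewrite mulrC in yx.
  rewrite -(euler_diag_nat p1 k.+1 yx); apply: eq_lsum => m /=.
  rewrite ifT; first by rewrite /F mulrC.
  by apply/eqP; rewrite NegzE; lia.
- by move=> m m' /(congr1 fst).
- apply: (lsmall_comp (h := fun m => (m, m + k.+1)%N)) => [m m' /(congr1 fst)//|].
  exact: lsmall_if.
- move=> [m1 m2] /(_ m1) ne; rewrite ifF//; apply: contraNF ne => /eqP.
  by rewrite NegzE => m12; apply/eqP; congr (_, _); move: m12 => /=; lia.
Qed.

(** Convergence of the theta series is inherited: its terms are fibre sums of a summable family. *)
Lemma lsmall_jterm_div : lsmall (fun x => jterm u e x / qpoch p p).
Proof.
have := lsmall_fibre (fun m => m.1%:Z - m.2%:Z) Fs.
by apply: eq_lsmall => x; rewrite euler_diag.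
Qed.

Lemma lsmall_jterm : lsmall (jterm u e).
Proof.
have := lsmallZ (qpoch p p) lsmall_jterm_div; apply: eq_lsmall => x.
by rewrite mulrCA mulrV ?qpoch_unit// mulr1.
Qed.

(** The two Euler expansions in z and p/z are multiplied and grouped by the difference of their
    exponents. *)
Lemma jacobi_triple :
  qpoch p p * qpoch (- lmono u e) p * qpoch (- lmono u^-1 (N%:Z - e)) p =
  lsum (jterm u e).
Proof.
rewrite -mulrA !qpoch_euler// lsumM; [|exact: lsmall_eulerc..].
rewrite (lsum_fibre (fun m => m.1%:Z - m.2%:Z) Fs).
under eq_lsum do rewrite euler_diag mulrC.
by rewrite lsumZ; [rewrite mulrA mulrV ?qpoch_unit ?mul1r | exact: lsmall_jterm].
Qed.

End JacobiTriple.

(** * Coloured sequences with prescribed gaps *)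

Section GapSequences.
Variables (K : comNzRingType) (C : finType) (w : C -> K) (D : C -> C -> nat).
Implicit Types (x y : nat * C) (l : seq (nat * C)) (d : C -> nat).

Definition gap x y := (x.1 + D y.2 x.2 <= y.1)%N.

(* sequences are listed from the smallest part up *)
Definition gapped d l := if l is x :: l' then (d x.2 <= x.1)%N && path gap x l' else true.

Definition seq_weight l : laurent K :=
  lmono (\prod_(x <- l) w x.2) (\sum_(x <- l) x.1)%N%:Z.

Definition gap_term d s l : laurent K :=
  if (size l == s) && gapped d l then seq_weight l else 0.

(* [d c] bounds below a smallest part of colour [c] *)
Definition gap_gf d s : laurent K := lsum (gap_term d s).

Lemma lsmall_gap_term d s : lsmall (gap_term d s).
Proof.
apply: (lsmallI (fun M => @finite_bounded_seq C (s + `|M|))) => M l /= lM.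
rewrite /gap_term; case: ifP => // /andP[/eqP ls _].
apply: (lboundedW _ (@lmono_bounded _ _ _)); rewrite leNgt; apply/negP => Ml.
by apply: lM; split; lia.
Qed.

Lemma gap_gf0 d : gap_gf d 0 = 1.
Proof.
rewrite /gap_gf (lsum_fset (A := [fset [::]]%fset)) => [|[|x l]]; last 2 first.
- by rewrite inE eqxx.
- by rewrite /gap_term.
by rewrite big_seq_fset1 /gap_term /= /seq_weight !big_nil.
Qed.

Definition shift m l : seq (nat * C) := [seq (x.1 + m, x.2)%N | x <- l].

Lemma shift_inj m : injective (shift m).
Proof. by apply: inj_map => -[a b] [a' b'] [/addIn-> ->]. Qed.

(** Only differences enter [gap]: lowering all parts by m turns the condition against the preceding
    part into a lower bound on the smallest remaining one. *)
Lemma path_gap_shift m c l :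
  path gap (m, c) (shift m l) = gapped (fun c' => D c' c) l.
Proof.
case: l => [|x l] //=; congr (_ && _).
  by rewrite /gap /= [(x.1 + m)%N]addnC leq_add2l.
elim: l x => //= y l IH x; rewrite -IH; congr (_ && _).
by rewrite /gap /= addnAC leq_add2r.
Qed.

Lemma path_gap_shiftE x l : path gap x l -> exists l', l = shift x.1 l'.
Proof.
move=> xl; exists [seq (y.1 - x.1, y.2)%N | y <- l].
rewrite /shift -map_comp -[LHS]map_id; apply/eq_in_map => y yl /=.
suff xy : (x.1 <= y.1)%N by rewrite subnK//; case: (y).
elim: l x xl yl => // z l IH x /= /andP[xz zl]; rewrite in_cons.
have {xz} xz : (x.1 <= z.1)%N by apply: leq_trans xz; rewrite leq_addr.
by move=> /predU1P[->//|/(IH _ zl)]; apply: leq_trans.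
Qed.

Lemma seq_weight_shift m c l :
  seq_weight ((m, c) :: shift m l) =
  (w c)%:L * 'q ^+ (m * (size l).+1) * seq_weight l.
Proof.
rewrite /seq_weight !big_cons !big_map /= big_split /= lqX !lmonoM mulr1 add0r.
by congr lmono; rewrite big_const_seq iter_addn_0 count_predT; lia.
Qed.

(* The excess of the smallest part over [d c] contributes to all parts, whence
   the geometric series. *)
Lemma gap_gf_rec d s :
  gap_gf d s.+1 = \sum_c (w c)%:L * 'q ^+ (s.+1 * d c) * (1 - 'q ^+ s.+1)^-1 *
                         gap_gf (fun c' => D c' c) s.
Proof.
(* A nonempty sequence is encoded by the colour of its smallest part, the excess of that part over
   [d], and the other parts lowered by the smallest one. *)
pose h (t : C * (nat * seq (nat * C))) : seq (nat * C) :=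
  let m := (d t.1 + t.2.1)%N in (m, t.1) :: shift m t.2.2.
have hI : injective h.
  move=> [c [e l]] [c' [e' l']] [+ cc]; subst c' => /addnI ee; subst e'.
  by move=> /shift_inj->.
have Gh t : gap_term d s.+1 (h t) =
    (w t.1)%:L * 'q ^+ (s.+1 * d t.1) *
    (('q ^+ s.+1) ^+ t.2.1 * gap_term (fun c' => D c' t.1) s t.2.2).
  case: t => c [e l]; rewrite /gap_term /= eqSS size_map leq_addr /=.
  rewrite path_gap_shift; case: eqP => [<-|_] /=; last by rewrite !mulr0.
  case: ifP => _; last by rewrite !mulr0.
  rewrite seq_weight_shift !mulrA; congr (_ * _); rewrite -!mulrA; congr (_ * _).
  by rewrite -exprM -exprD; congr (_ ^+ _)=> /=; lia.
have qs : lbounded 1 ('q ^+ s.+1 : laurent K).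
  by rewrite lqX; apply: (lboundedW _ (@lmono_bounded _ _ _)); lia.
have h0 l : (forall t, h t != l) -> gap_term d s.+1 l = 0.
  case: l => [|[m c] l] hl; first by rewrite /gap_term.
  rewrite /gap_term /=; case: ifP => // /and3P[_ dm /path_gap_shiftE[l' ll']].
  have /eqP[] := hl (c, (m - d c, l'))%N.
  by rewrite /h /= subnKC// ll'.
have Gs : lsmall (gap_term d s.+1 \o h).
  by apply: lsmall_comp => //; exact: lsmall_gap_term.
rewrite /gap_gf (lsum_reindex hI Gs h0) lsum_pair// lsum_fin.
apply: eq_bigr => c _ /=; under eq_lsum do rewrite Gh /=.
have Fs := lsmall_geometric qs; have Gs' := lsmall_gap_term (fun c' => D c' c) s.
rewrite lsumZ; last exact: (lsmallM Fs Gs').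
by rewrite -(lsumM Fs Gs') lsum_geometric// !mulrA.
Qed.

(** All s parts are at least the smallest one, which is at least e. *)
Lemma gap_gf_bounded d s e : (forall c, (e <= d c)%N) ->
  lbounded (s * e)%N%:Z (gap_gf d s).
Proof.
move=> de; apply: lsum_bounded (lsmall_gap_term _ _) _ => l; rewrite /gap_term.
case: ifP => // /andP[/eqP <- dl]; apply: (lboundedW _ (@lmono_bounded _ _ _)).
rewrite lez_nat; case: l dl => [|x l] //= /andP[dx xl].
have [l' ->] := path_gap_shiftE xl.
rewrite /shift size_map big_cons big_map big_split /= big_const_seq iter_addn_0.
rewrite count_predT; have := leq_mul (leqnn (size l').+1) (leq_trans (de x.2) dx).
by rewrite -/(x.1) !mulSn mulnC; lia.
Qed.

End GapSequences.

(** * The two counting series *)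

Lemma prod_count (R : comNzRingType) (I : finType) (T : Type) (f : T -> I)
    (c : I -> R) (l : seq T) :
  \prod_(x <- l) c (f x) = \prod_i c i ^+ count (fun x => f x == i) l.
Proof.
elim: l => [|x l IH]; first by rewrite big_nil big1.
rewrite big_cons IH [in RHS](bigD1 (f x))//= (bigD1 (f x))//= eqxx add1n exprS.
rewrite mulrA; congr (_ * _); apply: eq_bigr => i /negPf ix.
by rewrite eq_sym ix.
Qed.

Section ColourSeries.
Variables (K : comUnitRingType) (n : nat) (a : nat -> K).
Hypothesis a_unit : forall i, (i < n)%N -> a i \is a GRing.unit.

(** Turns a counting series into a sum over the counted objects: the fibre of the statistics over
    (m, u, v) is the finite set whose cardinal is the coefficient. *)
Lemma colour_seriesE (T : choiceType) (X : pred T) (m : T -> nat)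
    (u v : T -> {ffun 'I_n -> nat}) cnt :
  (forall M, finite_set [set t | X t /\ (m t <= M)%N]%classic) ->
  (forall x y z, cnt x y z =
     #|` fset_set [set t | X t /\ (m t, u t, v t) = (x, finfun y, finfun z)]%classic|) ->
  let F t := if X t then lmono (\prod_(i < n) a i ^ ((u t i)%:Z - (v t i)%:Z)) (m t)%:Z
             else 0 in
  lsmall F /\ colour_series a cnt = lsum F.
Proof.
move=> fin cntE F.
have Fs : lsmall F.
  apply: (lsmallI (fun M => fin `|M|%N)) => M t /= tM; rewrite /F; case: ifP => // Xt.
  apply: (lboundedW _ (@lmono_bounded _ _ _)); rewrite leNgt; apply/negP => Mt.
  by apply: tM; split=> //; lia.
split=> //; rewrite (lsum_fibre (fun t => (m t, u t, v t)) Fs).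
apply: eq_lsum => -[[x y] z].
rewrite /colour_term cntE !ffunK.
set A := [set t | _]%classic.
have finA : finite_set A.
  by apply: sub_finite_set (fin x) => t [Xt [mx _ _]] /=; rewrite mx.
have AE t : (t \in fset_set A) = X t && ((m t, u t, v t) == (x, y, z)).
  rewrite in_fset_set//; apply/idP/idP; rewrite inE /A /=.
    by move=> [-> ->]; rewrite eqxx.
  by move=> /andP[-> /eqP ->].
rewrite (lsum_fset (A := fset_set A)) => [|t]; last first.
  by rewrite AE /F; case: eqP; case: (X t).
transitivity (\sum_(t <- fset_set A) lmono (\prod_(i < n) a i ^ ((y i)%:Z - (z i)%:Z)) x%:Z).
  rewrite card_fset_sum1 natr_sum -mulrA mulr_suml; apply: eq_bigr => t _.
  rewrite mul1r lqX (eq_bigr (fun i : 'I_n => (a i ^ ((y i)%:Z - (z i)%:Z))%:L)).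
    by rewrite -rmorph_prod lmonoM mul1r addr0.
  by move=> i _; rewrite rmorphXz ?a_unit.
rewrite big_seq [in RHS]big_seq; apply: eq_bigr => t; rewrite AE => /andP[Xt tE].
by rewrite tE /F Xt; move/eqP: tE => [-> -> ->].
Qed.

Let A (i : 'I_n) : K := a i.
Let B (i : 'I_n) : K := (a i)^-1.

Let weightE (T : Type) (f g : T -> 'I_n) (l r : seq T) :
  \prod_(i < n) a i ^ ((count (fun x => f x == i) l)%:Z - (count (fun x => g x == i) r)%:Z) =
  \prod_(x <- l) A (f x) * \prod_(x <- r) B (g x).
Proof.
rewrite !prod_count -big_split /=; apply: eq_bigr => i _.
by rewrite exprzDr ?a_unit// -exprnN exprVn.
Qed.

Definition Deltan (c c' : colour n) : nat := absz (Delta c c').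

(** [Delta] is nonnegative because each subtracted truth value implies the one before it. *)
Lemma Deltan_int c c' : (Deltan c c')%:Z = Delta c c'.
Proof.
rewrite /Deltan gez0_abs// /Delta; case: c c' => [i k] [i' k'] /=.
have e1 : ([&& i == k & k == i'] <= (i' <= i))%N.
  by case: andP => // -[/eqP-> /eqP->]; rewrite leqnn.
have e2 : ([&& k == i' & i' == k'] <= (k <= k'))%N.
  by case: andP => // -[/eqP-> /eqP->]; rewrite leqnn.
move: e1 e2; move: (nat_of_bool (i' <= i)%N) (nat_of_bool (k <= k')%N) => r s.
by move: (nat_of_bool (_ && _)) (nat_of_bool (_ && _)) => x y; lia.
Qed.

Definition colour_weight (c : colour n) : K := A c.1 * B c.2.

(** Gaps are nonnegative, so positivity of the smallest part makes all parts positive. *)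
Lemma in_Pn_rev (l : seq (nat * colour n)) : in_Pn (rev l) = gapped Deltan (fun=> 1%N) l.
Proof.
rewrite /in_Pn all_rev rev_sorted.
case: l => [|x l] //=.
have -> : path (fun z x0 => Delta x0.2 z.2 <= x0.1%:Z - z.1%:Z) x l = path (gap Deltan) x l.
  by apply: eq_path => y z; rewrite /gap -Deltan_int lerBrDl -PoszD lez_nat.
rewrite -andbA; case: (ltnP 0 x.1) => //= x0.
have [/path_gap_shiftE[l' ->]|] := boolP (path _ x l); rewrite ?andbF ?andbT//.
by apply/allP => y /mapP[z _ ->] /=; rewrite addn_gt0 x0 orbT.
Qed.

Lemma Pseries_gap : colour_series a (@Pcount n) = lsum (gap_gf colour_weight Deltan (fun=> 1%N)).
Proof.
pose u (l : seq (nat * colour n)) := [ffun i : 'I_n => count (fun x => x.2.1 == i) l].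
pose v (l : seq (nat * colour n)) := [ffun i : 'I_n => count (fun x => x.2.2 == i) l].
have [] := @colour_seriesE _ (@in_Pn n) (fun l => \sum_(x <- l) x.1)%N u v (@Pcount n).
- move=> M; apply: sub_finite_set (finite_bounded_seq (colour n) M) => l /= [lP lM].
  split=> //; apply: leq_trans lM; have /andP[/allP l0 _] := lP.
  rewrite -sum1_size big_seq_cond [X in (_ <= X)%N]big_seq_cond.
  by apply: leq_sum => x /andP[/l0].
- move=> x y z; rewrite /Pcount; congr (#|` fset_set _|); apply/predeqP => l /=.
  split=> [[lP <- lu lv]|[lP [<- /ffunP lu /ffunP lv]]].
    by split=> //; congr (_, _, _); apply/ffunP => i; rewrite !ffunE ?lu ?lv.
  by split=> // i; [have := lu i | have := lv i]; rewrite !ffunE.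
set F := (F in lsmall F -> _); move=> Fs ->.
have revI : injective (@rev (nat * colour n)) := inv_inj revK.
rewrite (lsum_reindex (h := @rev _)) //; first last.
- by move=> l /(_ (rev l)); rewrite revK eqxx.
- exact: lsmall_comp.
have Fs' : lsmall (F \o @rev _) by exact: lsmall_comp.
rewrite (lsum_fibre size Fs'); apply: eq_lsum => s; apply: eq_lsum => l.
rewrite /gap_term /F /= in_Pn_rev; case: eqP => //= _; case: ifP => // _.
rewrite /seq_weight; congr lmono.
  under eq_bigr do rewrite !ffunE.
  by rewrite weightE -big_split /=; apply: perm_big; rewrite perm_rev.
by congr Posz; apply: perm_big; rewrite perm_rev.
Qed.

Lemma Fseries_gap : colour_series a (@Fcount n) =
  lsum (fun s => 'q ^+ s *
    (gap_gf A (fun i i' => (i' <= i)%N : nat) (fun=> 0%N) s *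
     gap_gf B (fun k k' => (k <= k')%N : nat) (fun=> 0%N) s)).
Proof.
pose T := (seq (nat * 'I_n) * seq (nat * 'I_n))%type.
pose u (p : T) := [ffun i : 'I_n => count (fun x => x.2 == i) p.1].
pose v (p : T) := [ffun i : 'I_n => count (fun x => x.2 == i) p.2].
pose m (p : T) := (size p.1 + \sum_(x <- p.1) x.1 + \sum_(x <- p.2) x.1)%N.
have [] := @colour_seriesE _ (@frobenius n) m u v (@Fcount n).
- move=> M; have fin := finite_bounded_seq 'I_n M.
  apply: sub_finite_set (finite_setX fin fin) => -[l r] /= [/and3P[/eqP/= lr _ _]].
  by rewrite /m /= => lM; split; split=> /=; lia.
- move=> x y z; rewrite /Fcount; congr (#|` fset_set _|); apply/predeqP => p /=.
  split=> [[lP <- lu lv]|[lP [<- /ffunP lu /ffunP lv]]].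
    by split=> //; congr (_, _, _); apply/ffunP => i; rewrite !ffunE ?lu ?lv.
  by split=> // i; [have := lu i | have := lv i]; rewrite !ffunE.
set F := (F in lsmall F -> _); move=> Fs ->.
pose h (p : T) : T := (rev p.1, rev p.2).
have hK : involutive h by move=> [l r]; rewrite /h /= !revK.
rewrite (lsum_reindex (h := h)); first last.
- by move=> p /(_ (h p)); rewrite hK eqxx.
- by apply: lsmall_comp => //; exact: inv_inj.
- exact: inv_inj.
have Fs' : lsmall (F \o h) by apply: lsmall_comp => //; exact: inv_inj.
rewrite (lsum_fibre (fun p => size p.1) Fs'); apply: eq_lsum => s.
set RA := gap_gf _ _ _; set RB := gap_gf _ _ _.
rewrite /RA /RB /gap_gf lsumM; [|exact: lsmall_gap_term..].
rewrite -lsumZ; last by apply: lsmallM; exact: lsmall_gap_term.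
apply: eq_lsum => -[l r] /=; rewrite /F /gap_term /frobenius /= !size_rev !rev_sorted.
(* Equal values are allowed exactly when the colour index strictly drops from the smaller to the
   larger part, which is a gap of 0; otherwise the gap is 1. *)
have -> : sorted (fun z x => gt_a x z) l =
    gapped (fun i i' : 'I_n => (i' <= i)%N : nat) (fun=> 0%N) l.
  case: l => //= x l; apply: eq_path => y z; rewrite /gap /gt_a.
  by rewrite [(z.2 < y.2)%N]ltnNge; case: (y.2 <= z.2)%N => /=; lia.
have -> : sorted (fun z x => gt_b x z) r =
    gapped (fun i i' : 'I_n => (i <= i')%N : nat) (fun=> 0%N) r.
  case: r => //= x r; apply: eq_path => y z; rewrite /gap /gt_b.
  by rewrite [(y.2 < z.2)%N]ltnNge; case: (z.2 <= y.2)%N => /=; lia.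
have [<-|_] /= := eqVneq (size l) s; last by rewrite mul0r mulr0.
rewrite eq_sym; case: eqP => [rl|_] /=; last by rewrite !mulr0.
case: (gapped _ _ l) => /=; last by rewrite mul0r mulr0.
case: (gapped _ _ r) => /=; last by rewrite !mulr0.
rewrite /seq_weight lqX !lmonoM mul1r; congr lmono.
  under eq_bigr do rewrite !ffunE.
  by rewrite weightE; congr (_ * _); apply: perm_big; rewrite perm_rev.
rewrite /m /= size_rev !PoszD addrA; congr (_ + Posz _ + Posz _);
  by apply: perm_big; rewrite perm_rev.
Qed.

End ColourSeries.

(** * Coloured partitions versus Frobenius partitions *)

Section Bilinear.
Variables (R : comNzRingType) (W : R) (n i0 j0 : nat).
Hypotheses (i0n : (i0 < n)%N) (j0n : (j0 <= n)%N).

(** [W] raised to the two summands of the gap to a colour with first index [i0] and lower index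
    [j0], see [DeltanE]; [weight_lt] serves the colours a_i b_i, [weight_le] the others. *)
Definition weight_le i : R := if (i0 <= i)%N then W else 1.
Definition weight_lt i : R := if (i0 < i)%N then W else 1.
Definition weight_b k : R := if (k < j0)%N then W else 1.

Variables (x y : nat -> R) (U V : R).
Hypotheses (VU : V * U = W) (x0 : x 0%N = U * x n) (yn : y n = U * y 0%N).

Let dx i := x i.+1 - x i.
Let dy k := y k - y k.+1.

(** The weight is constant away from [i0], so the sum telescopes up to one correction there. *)
Let sum_dx m : \sum_(i < m) weight_le i * dx i =
  weight_lt m * x m - x 0%N + (i0 < m)%N%:R * (1 - W) * x i0.
Proof.
elim: m => [|m IH]; first by rewrite big_ord0 /weight_lt /=; ring.
rewrite big_ord_recr /= IH /weight_lt /weight_le /dx ltnS.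
by case: (ltngtP i0 m) => [_|_|->] /=; ring.
Qed.

Let sum_dy m : \sum_(k < m) weight_b k * dy k =
  W * y 0%N - (if (m <= j0)%N then W else 1) * y m + (j0 < m)%N%:R * (1 - W) * y j0.
Proof.
elim: m => [|m IH]; first by rewrite big_ord0 /=; ring.
rewrite big_ord_recr /= IH /weight_b /dy ltnS.
by case: (ltngtP j0 m) => [_|_|->] /=; ring.
Qed.

Let sum_dx_V k : (k < n)%N -> \sum_(i < n) weight_le i * V ^+ (i < k) * dx i =
  (1 - W) * x i0 - (1 - V) * (weight_lt k * x k + (i0 < k)%N%:R * (1 - W) * x i0).
Proof.
move=> kn.
have -> : \sum_(i < n) weight_le i * V ^+ (i < k) * dx i =
    \sum_(i < n) weight_le i * dx i - (1 - V) * \sum_(i < n) (if (i < k)%N then weight_le i * dx i else 0).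
  rewrite mulr_sumr -sumrB; apply: eq_bigr => i _.
  by case: ifP => _ /=; ring.
have -> : \sum_(i < n) (if (i < k)%N then weight_le i * dx i else 0) = \sum_(i < k) weight_le i * dx i.
  by rewrite -big_mkcond /= (big_ord_widen n (fun i => weight_le i * dx i))// ltnW.
by rewrite !sum_dx /weight_lt i0n x0 -VU /=; ring.
Qed.

(* Both sides are bilinear in [x] and [y], and the double sum telescopes. *)
Lemma bilinear_core :
  \sum_(i < n) \sum_(k < n) weight_le i * weight_b k * V ^+ (i < k) * (dx i * dy k) +
  (1 - V) * \sum_(i < n) (weight_lt i * weight_b i * (x i * y i) - weight_le i * weight_b i * (x i * y i.+1)) =
  (1 - W) ^+ 2 * V ^+ (i0 < j0) * (x i0 * y j0).
Proof.
(* Once the sum over i is done, the terms in [x k] cancel those of the second sum except at k = i0,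
   where [weight_lt] and [weight_le] differ by 1 - W. *)
transitivity ((1 - W) * x i0 * \sum_(k < n)
   (weight_b k * dy k - (1 - V) * (if (i0 < k)%N then weight_b k * dy k else 0) +
   (if k == i0 :> nat then (1 - V) * weight_b k * y k.+1 else 0))).
  rewrite exchange_big /= !mulr_sumr; rewrite -big_split /=; apply: eq_bigr => k _.
  have -> : \sum_(i < n) weight_le i * weight_b k * V ^+ (i < k) * (dx i * dy k) =
      (\sum_(i < n) weight_le i * V ^+ (i < k) * dx i) * (weight_b k * dy k).
    by rewrite mulr_suml; apply: eq_bigr => i _; ring.
  rewrite sum_dx_V // /weight_le /weight_lt /dy.
  by case: (ltngtP i0 k) => [_|_|->] /=; ring.
(* As 1 - (1 - V)[i0 < k] = V + (1 - V)[k <= i0], a full and a truncated sum remain, both evaluated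
   by [sum_dy]. *)
have -> : \sum_(k < n)
   (weight_b k * dy k - (1 - V) * (if (i0 < k)%N then weight_b k * dy k else 0) +
   (if k == i0 :> nat then (1 - V) * weight_b k * y k.+1 else 0)) =
   V * (\sum_(k < n) weight_b k * dy k) +
   (1 - V) * (\sum_(k < i0.+1) weight_b k * dy k + weight_b i0 * y i0.+1).
  rewrite [X in _ = _ + _ * (X + _)](big_ord_widen n (fun k => weight_b k * dy k) i0n).
  rewrite [X in _ = _ + _ * (X + _)]big_mkcond big_split /=.
  rewrite -[X in _ + X = _]big_mkcond /=.
  rewrite [in RHS]mulrDr [in RHS]addrA !mulr_sumr -big_split /=.
  congr (_ + _); last first.
    by rewrite (big_pred1 (Ordinal i0n))//= mulrA.
  by apply: eq_bigr => k _; rewrite ltnS; case: ltnP => _; ring.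
rewrite !sum_dy /weight_b ltnS yn -VU.
have -> : (if (n <= j0)%N then V * U else 1) * (U * y 0%N) =
    U * y 0%N - (if (n <= j0)%N then (1 - V * U) * y j0 else 0).
  by case: (ltngtP n j0) j0n => [_|_|<-] // _; rewrite ?yn; ring.
by rewrite ltnNge; case: (leqP n j0) => nj /=; case: (ltnP i0 j0) => ij /=; ring.
Qed.

End Bilinear.

(** * Row functions and the recursion for their bilinear combination *)

Section PrimcFrobenius.
Variables (K : comUnitRingType) (n : nat) (A B : nat -> laurent K).

Lemma q_bounded : lbounded 1 ('q : laurent K).
Proof. exact: lmono_bounded. Qed.

Let qS_unit m : 1 - 'q ^+ m.+1 \is a @GRing.unit (laurent K).
Proof. by apply: lunit1B; apply: expS_bounded; exact: q_bounded. Qed.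

(** The recursion [gap_gf_rec] for upper rows of r parts whose smallest part must be positive if its
    colour index is at least [i0]; at i0 = n there is no restriction. *)
Fixpoint row_a (r i0 : nat) : laurent K :=
  if r is s.+1 then
    (1 - 'q ^+ s.+1)^-1 * \sum_(i < n) A i * ('q ^+ s.+1) ^+ (i0 <= i)%N * row_a s i
  else 1.

(** The same for lower rows, with positivity required for colour indices below [j0]. *)
Fixpoint row_b (r j0 : nat) : laurent K :=
  if r is s.+1 then
    (1 - 'q ^+ s.+1)^-1 * \sum_(k < n) B k * ('q ^+ s.+1) ^+ (k < j0)%N * row_b s k.+1
  else 1.

(** The two sums differ only at index i, by a factor 1 - q^(r+1) that the leading inverse
    cancels. *)
Lemma row_a_diff r i : (i < n)%N -> row_a r.+1 i.+1 - row_a r.+1 i = A i * row_a r i.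
Proof.
move=> ltin; rewrite /= -mulrBr -sumrB (bigD1 (Ordinal ltin)) //= big1.
  rewrite ltnn leqnn expr0 expr1 addr0; apply: (mulrI (qS_unit r)).
  by rewrite [LHS]mulrA mulrV// mul1r; move: ('q ^+ _) => Q; ring.
move=> k /eqP ki; rewrite [(i <= k)%N]leq_eqVlt; case: eqP => [ik|_]; last by rewrite subrr.
by case: ki; apply: val_inj.
Qed.

Lemma row_b_diff r k : (k < n)%N -> row_b r.+1 k - row_b r.+1 k.+1 = B k * row_b r k.+1.
Proof.
move=> ltkn; rewrite /= -mulrBr -sumrB (bigD1 (Ordinal ltkn)) //= big1.
  rewrite ltnn leqnn expr0 expr1 addr0; apply: (mulrI (qS_unit r)).
  by rewrite [LHS]mulrA mulrV// mul1r; move: ('q ^+ _) => Q; ring.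
move=> k' /eqP ki; rewrite [(k' < k.+1)%N]ltnS [(k' <= k)%N]leq_eqVlt.
case: eqP => [ik|_]; last by rewrite subrr.
by case: ki; apply: val_inj.
Qed.

(** At 0 all parts are forced to be positive, at n none is: all r parts are raised by one. *)
Lemma row_a_wrap r : row_a r 0%N = 'q ^+ r * row_a r n.
Proof.
case: r => [|r] /=; first by rewrite expr0 mulr1.
rewrite mulrCA; congr (_ * _); rewrite mulr_sumr; apply: eq_bigr => i _.
by rewrite leqNgt ltn_ord; ring.
Qed.

Lemma row_b_wrap r : row_b r n = 'q ^+ r * row_b r 0%N.
Proof.
case: r => [|r] /=; first by rewrite expr0 mulr1.
rewrite mulrCA; congr (_ * _); rewrite mulr_sumr; apply: eq_bigr => i _.
by rewrite ltn_ord; ring.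
Qed.

Hypothesis AB : forall i, (i < n)%N -> A i * B i = 1.

Definition tau N i0 j0 : laurent K :=
  \sum_(r < N.+1) qff 'q N r * ('q ^+ (N - r) ^+ (i0 < j0)%N * (row_a r i0 * row_b r j0)).

(* The terms of degree [r.+1] in the double sum are bilinear in differences of
   [row_a r.+1] and [row_b r.+1]; [A i * B i = 1] lets the missing diagonal be
   traded for terms of degree [r], after which [bilinear_core] applies. *)
Lemma tau_rec N i0 j0 : (i0 < n)%N -> (j0 <= n)%N ->
  (1 - 'q ^+ N.+1) * tau N.+1 i0 j0 =
  \sum_(i < n) \sum_(k < n)
    (if i == k then weight_lt ('q ^+ N.+1) i0 i * weight_b ('q ^+ N.+1) j0 i * tau N i i
     else A i * B k * (weight_le ('q ^+ N.+1) i0 i * weight_b ('q ^+ N.+1) j0 k) * tau N i k.+1).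
Proof.
move=> i0n j0n; set W := 'q ^+ N.+1.
pose Cu u := 'q ^+ (N.+1 - u) ^+ (i0 < j0)%N * (row_a u i0 * row_b u j0).
pose Au u := \sum_(i < n) \sum_(k < n) weight_le W i0 i * weight_b W j0 k *
  'q ^+ (N.+1 - u) ^+ (i < k)%N * ((row_a u i.+1 - row_a u i) * (row_b u k - row_b u k.+1)).
pose Bu u := \sum_(i < n) (weight_lt W i0 i * weight_b W j0 i * (row_a u i * row_b u i) -
   weight_le W i0 i * weight_b W j0 i * (row_a u i * row_b u i.+1)).
(* Here U = q^u and V = q^(N+1-u), so that VU = W. *)
have core u : (u <= N.+1)%N -> Au u + (1 - 'q ^+ (N.+1 - u)) * Bu u = (1 - W) ^+ 2 * Cu u.
  move=> uN; rewrite /Cu [RHS]mulrA.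
  apply: (@bilinear_core _ W n i0 j0 i0n j0n (row_a u) (row_b u) ('q ^+ u)).
  - by rewrite -exprD subnK.
  - exact: row_a_wrap.
  - exact: row_b_wrap.
(* In degree 0 the row functions are constant, so [Au] vanishes and one factor 1 - W cancels. *)
have B0 : Bu 0%N = (1 - W) * Cu 0%N.
  have A0 : Au 0%N = 0.
    rewrite /Au big1 => [//|i _]; rewrite big1 => [//|k _].
    by rewrite -[row_a 0 i.+1]/1 -[row_a 0 i]/1 subrr mul0r mulr0.
  apply: (mulrI (qS_unit N)); have := core 0%N (leq0n _).
  by rewrite subn0 A0 add0r => ->; rewrite expr2 -mulrA.
have RHSE : \sum_(i < n) \sum_(k < n)
    (if i == k then weight_lt W i0 i * weight_b W j0 i * tau N i i
     else A i * B k * (weight_le W i0 i * weight_b W j0 k) * tau N i k.+1) =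
    \sum_(r < N.+1) qff 'q N r * (Au r.+1 + Bu r).
  pose g (r : nat) (i k : 'I_n) : laurent K :=
    if i == k then weight_lt W i0 i * weight_b W j0 i * (row_a r i * row_b r i)
    else A i * B k * (weight_le W i0 i * weight_b W j0 k) *
      ('q ^+ (N - r) ^+ (i < k.+1)%N * (row_a r i * row_b r k.+1)).
  transitivity (\sum_(r < N.+1) qff 'q N r * \sum_(i < n) \sum_(k < n) g r i k).
    under [RHS]eq_bigr do rewrite mulr_sumr.
    rewrite [RHS]exchange_big; apply: eq_bigr => i _.
    under [RHS]eq_bigr do rewrite mulr_sumr.
    rewrite [RHS]exchange_big; apply: eq_bigr => k _.
    rewrite /g /tau; case: (i == k); rewrite mulr_sumr; apply: eq_bigr => r _.
      by rewrite ltnn expr0 mul1r mulrCA.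
    by rewrite mulrCA.
  apply: eq_bigr => r _; congr (_ * _).
  rewrite /Au /Bu -big_split; apply: eq_bigr => i _ /=.
  rewrite (bigD1 i)//= [X in _ = X + _](bigD1 i)//= /g eqxx ltnn expr0 mulr1.
  rewrite (row_a_diff r (ltn_ord i)) (row_b_diff r (ltn_ord i)).
  have -> : A i * row_a r i * (B i * row_b r i.+1) = row_a r i * row_b r i.+1.
    by rewrite mulrACA AB// mul1r.
  have -> (b c d : laurent K) : b + d + (c - b) = c + d by ring.
  congr (_ + _); apply: eq_bigr => k ki.
  rewrite eq_sym (negPf ki) (row_b_diff r (ltn_ord k)) subSS ltnS leq_eqVlt.
  have /negPf -> : i != k :> nat by apply: contra ki => /eqP/val_inj->.
  by rewrite /=; ring.
rewrite RHSE.
(* After [core] replaces [Au], the [Bu] terms telescope, since [qff] acquires the factor 1 - q^(N-m)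
   from m to m + 1. The last boundary term vanishes at m = N + 1. *)
have part m : (m <= N.+1)%N -> \sum_(r < m) qff 'q N r * (Au r.+1 + Bu r) =
   \sum_(r < m) qff 'q N r * ((1 - W) ^+ 2 * Cu r.+1) + Bu 0%N - qff 'q N m * Bu m.
  elim: m => [|m IH] mN; first by rewrite !big_ord0 qff0; ring.
  rewrite !big_ord_recr /= IH 1?ltnW// -core// subSS qffS; ring.
rewrite part// [qff _ N N.+1]qff_small// mul0r subr0 B0.
rewrite /tau big_ord_recl mulrDr qff0 mul1r [RHS]addrC; congr (_ + _).
rewrite mulr_sumr; apply: eq_bigr => r _; rewrite lift0 qffSS /Cu.
by rewrite -/W; ring.
Qed.

End PrimcFrobenius.

(** * Equality of the partition series and the Frobenius series *)

Section PartitionsFrobenius.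
Variables (K : comUnitRingType) (n : nat) (a : nat -> K).
Hypothesis a_unit : forall i, (i < n)%N -> a i \is a GRing.unit.

Let A i : laurent K := (a i)%:L.
Let B i : laurent K := ((a i)^-1)%:L.
Let wA (i : 'I_n) : K := a i.
Let wB (i : 'I_n) : K := (a i)^-1.
Let w := @colour_weight K n a.

Lemma gap_gf_row_a s i0 :
  gap_gf wA (fun i i' => (i' <= i)%N : nat) (fun i => (i0 <= i)%N : nat) s =
  row_a n A s i0.
Proof.
elim: s i0 => [|s IH] i0; first exact: gap_gf0.
rewrite gap_gf_rec /= mulr_sumr; apply: eq_bigr => i _.
rewrite IH exprM -[(wA i)%:L]/(A i).
by move: (A i) (row_a _ _ _ _) (_ ^+ (_ <= _)%N) (_^-1) => ? ? ? ?; ring.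
Qed.

Lemma gap_gf_row_b s j0 :
  gap_gf wB (fun k k' => (k <= k')%N : nat) (fun k => (k < j0)%N : nat) s =
  row_b n B s j0.
Proof.
elim: s j0 => [|s IH] j0; first exact: gap_gf0.
rewrite gap_gf_rec /= mulr_sumr; apply: eq_bigr => k _.
have -> : (fun k' : 'I_n => (k' <= k)%N : nat) = (fun k' => (k' < k.+1)%N : nat).
  by apply/funext => k'; rewrite ltnS.
rewrite IH exprM -[(wB k)%:L]/(B k).
by move: (B k) (row_b _ _ _ _) (_ ^+ (_ < _)%N) (_^-1) => ? ? ? ?; ring.
Qed.

Let AB i : (i < n)%N -> A i * B i = 1.
Proof. by move=> /a_unit aU; rewrite /A /B -rmorphM mulrV// rmorph1. Qed.

(* When [c.1 = c.2] the second correction of [Delta] lowers the index of [b]. *)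
Definition lower_index (c : colour n) : nat := (c.2.+1 - (c.1 == c.2))%N.

(** For fixed c the gap separates into a function of the first index of c' and a function of
    [lower_index c'], matching the two factors in [tau_rec]. *)
Lemma DeltanE (c c' : colour n) : Deltan c c' =
  if c.1 == c.2 then ((c'.1 < c.1) + (c.1 < lower_index c'))%N
  else ((c'.1 <= c.1) + (c.2 < lower_index c'))%N.
Proof.
apply/eqP; rewrite -eqz_nat Deltan_int; apply/eqP; rewrite /Delta /lower_index.
case: c c' => [i k] [i' k']; rewrite -!val_eqE /=.
move: (i : nat) (k : nat) (i' : nat) (k' : nat) => {}i {}k {}i' {}k'.
case: (eqVneq i k) => [->|ik]; case: (eqVneq i' k') => [->|i'k'] /=; lia.
Qed.

(** Both sides are 1 for s = 0 and obey the same recursion; the colours a_k b_k have weight 1. *)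
Lemma gap_gf_tau s c' : gap_gf w (@Deltan n) (fun c => Deltan c c') s =
  tau n A B s c'.1 (lower_index c').
Proof.
elim: s c' => [|s IH] c'.
  by rewrite gap_gf0 /tau big_ord1 qff0 expr1n !mul1r.
have qU : 1 - 'q ^+ s.+1 \is a @GRing.unit (laurent K).
  by apply: lunit1B; apply: expS_bounded; exact: q_bounded.
apply: (mulrI qU); rewrite tau_rec //; last first.
  by rewrite /lower_index; apply: leq_trans (leq_subr _ _) (ltn_ord _).
rewrite gap_gf_rec mulr_sumr pair_big /=; apply: eq_bigr => -[i k] _ /=.
rewrite IH exprM DeltanE /lower_index /=.
have -> (x y z t : laurent K) : t * (x * y * t^-1 * z) = (t * t^-1) * (x * y * z) by ring.
rewrite mulrV// mul1r /w /colour_weight rmorphM /=.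
case: eqP => [->|ne].
  rewrite -[(a k)%:L]/(A k) -[((a k)^-1)%:L]/(B k) AB// mul1r subn1 /=.
  by congr (_ * _); rewrite exprD /weight_lt /weight_b; do 2 case: ifP.
rewrite subn0; congr (_ * _ * _).
by rewrite exprD /weight_le /weight_b; do 2 case: ifP.
Qed.

Hypothesis n_gt0 : (0 < n)%N.

(* [Delta c g = 1] unless [c = g]: parts [0] of colour [g] pad a partition with
   at most [N] parts. *)
Lemma gap_gf_ground N (g := (Ordinal n_gt0, Ordinal n_gt0)) :
  gap_gf w (@Deltan n) (fun c => Deltan c g) N =
  \sum_(s < N.+1) gap_gf w (@Deltan n) (fun=> 1%N) s.
Proof.
elim: N => [|N IH]; first by rewrite big_ord1 !gap_gf0.
rewrite big_ord_recr /= -IH.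
have qb : lbounded 1 ('q ^+ N.+1 : laurent K).
  by apply: expS_bounded; exact: q_bounded.
(* For c = g the gap is 0 on the left and 1 on the right; by [inv1BE] the difference is the function
   with N parts. *)
rewrite !gap_gf_rec (bigD1 g)//= [X in _ = _ + X](bigD1 g)//= addrA; congr (_ + _).
  have -> : Deltan g g = 0%N by rewrite DeltanE.
  have -> : w g = 1 by rewrite /w /colour_weight mulrV// a_unit.
  rewrite rmorph1 !mul1r muln0 muln1 expr0 mul1r {1}(inv1BE qb).
  by move: (_^-1) (gap_gf _ _ _ _) => D G; ring.
apply: eq_bigr => c cg; suff -> : Deltan c g = 1%N by [].
rewrite DeltanE /lower_index /= ?eqxx ?subnn ?ltn0 ?leq0n ?addn0.
case: eqP => [c12|//].
have c1 : (0 < c.1)%N.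
  rewrite lt0n; apply: contra cg => /eqP c10; apply/eqP.
  by rewrite [c]surjective_pairing -c12; congr (_, _); apply: val_inj.
by rewrite c1.
Qed.

Lemma Fseries_rows : colour_series a (@Fcount n) =
  lsum (fun r => 'q ^+ r * (row_a n A r n * row_b n B r 0)).
Proof.
rewrite Fseries_gap//; apply: eq_lsum => r.
rewrite -gap_gf_row_a -gap_gf_row_b.
have -> : (fun i : 'I_n => (n <= i)%N : nat) = (fun=> 0%N).
  by apply/funext => i; rewrite leqNgt ltn_ord.
by have -> : (fun k : 'I_n => (k < 0)%N : nat) = (fun=> 0%N) by apply/funext.
Qed.

Lemma row_bounded r : lbounded 0 (row_a n A r n) /\ lbounded 0 (row_b n B r 0).
Proof.
rewrite -gap_gf_row_a -gap_gf_row_b; split.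
  by have := @gap_gf_bounded K _ wA (fun i i' => (i' <= i)%N : nat)
    (fun i : 'I_n => (n <= i)%N : nat) r 0 (fun=> leq0n _); rewrite muln0.
by have := @gap_gf_bounded K _ wB (fun i i' => (i <= i')%N : nat)
  (fun k : 'I_n => (k < 0)%N : nat) r 0 (fun=> leq0n _); rewrite muln0.
Qed.

Lemma Pseries_Fseries : colour_series a (@Pcount n) = colour_series a (@Fcount n).
Proof.
rewrite Pseries_gap// Fseries_rows.
set f := fun s : nat => _ * (_ * _).
have fb r : lbounded r%:Z (f r).
  have [xb yb] := row_bounded r.
  by have := lboundedM (lboundedXn (m := r) (@q_bounded K)) (lboundedM xb yb); rewrite !addr0.
have pb s : lbounded s%:Z (gap_gf w (@Deltan n) (fun=> 1%N) s).
  by have := @gap_gf_bounded K _ w (@Deltan n) (fun=> 1%N) s 1 (fun=> leqnn _); rewrite muln1.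
apply: lbounded_eq => M; pose N := `|M|%N.
apply: (lboundedW (A := N.+1%:Z)); first by rewrite /N; lia.
apply: lbounded_trans (lsum_nat_approx (N := N.+1) pb) _.
(* The partial sum up to N parts is [tau] at N, 0, 0. Its factor [qff] at r is 1 modulo q^(N-r+1),
   and the r-th Frobenius term has order at least r. *)
rewrite -gap_gf_ground gap_gf_tau /tau /lower_index /= subn1 /=.
rewrite -opprB; apply: lboundedN.
apply: lbounded_trans (lsum_nat_approx (N := N.+1) fb) _.
rewrite -sumrB; apply: lbounded_sum => r _.
rewrite ?ltn0 expr0 mul1r row_a_wrap -[_ * _ * row_b _ _ _ _]mulrA -/(f r) -[X in X - _]mul1r -mulrBl.
have rN : (r <= N)%N by have := ltn_ord r; lia.
by apply: lboundedW (lboundedM (qff_1bounded (@q_bounded K) rN) (fb r)); lia.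
Qed.

End PartitionsFrobenius.

(** * The theta series *)

Lemma finite_ffun_sum n r :
  finite_set [set m : {ffun 'I_n -> nat} | (\sum_l m l <= r)%N]%classic.
Proof.
pose g (x : {ffun 'I_n -> 'I_r.+1}) : {ffun 'I_n -> nat} := [ffun l => x l : nat].
apply: (sub_finite_set (B := [set g x | x in setT]%classic)).
  move=> m mr; exists [ffun l => inord (m l)] => //.
  apply/ffunP => l; rewrite !ffunE inordK// ltnS; apply: leq_trans mr.
  by rewrite (bigD1 l) //= leq_addr.
by apply: finite_image; exact: finite_finset.
Qed.

(** * Coefficients of products of Euler series *)

Section Elementary.
Variables (K : comNzRingType) (n : nat).
Let q : laurent K := 'q.
Let q1 : lbounded 1 q.
Proof. exact: lmono_bounded. Qed.
Implicit Types x : 'I_n -> laurent K.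

Definition esum_term x r (m : {ffun 'I_n -> nat}) : laurent K :=
  if (\sum_l m l)%N == r then \prod_l eulerc q (x l) (m l) else 0.

(** The coefficient of z^r in the product of the (-z x_l; q)_oo, each expanded by Euler's
    identity. *)
Definition esum x r := lsum (esum_term x r).

Lemma lsmall_esum x r : lsmall (esum_term x r).
Proof.
apply: (lsmallI (A := fun=> [set m : {ffun 'I_n -> nat} | (\sum_l m l <= r)%N]%classic)).
  by move=> M; exact: finite_ffun_sum.
move=> M m /= mr; rewrite /esum_term; case: eqP => // mE.
by case: mr; rewrite mE.
Qed.

Lemma esum0 x : esum x 0 = 1.
Proof.
rewrite /esum (lsum_fset (A := [fset [ffun=> 0%N]]%fset)) ?big_seq_fset1.
  rewrite /esum_term big1 ?eqxx => [|l _]; last by rewrite ffunE.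
  by rewrite big1// => l _; rewrite ffunE eulerc0.
move=> m; rewrite inE /esum_term sum_nat_eq0 => m0; case: ifP => // /forallP mE.
case/eqP: m0; apply/ffunP => l; rewrite ffunE; exact/eqP/(implyP (mE l)).
Qed.

(** This is the substitution of zq for z. *)
Lemma esum_wrap x r : esum (fun l => x l * q) r = q ^+ r * esum x r.
Proof.
rewrite -lsumZ; last exact: lsmall_esum.
apply: eq_lsum => m; rewrite /esum_term; case: eqP => [<-|_]; last by rewrite mulr0.
rewrite -prodrXr -big_split /=; apply: eq_bigr => l _.
by rewrite /eulerc exprMn; move: (q ^+ 'C(_, 2)) (_^-1) => c D; ring.
Qed.

(* Comparison of coefficients in [1 + z x_i] times the product for [x']. *)
Lemma esum_diff x x' r i : x' i = x i * q -> (forall l, l != i -> x' l = x l) ->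
  esum x r.+1 - esum x' r.+1 = x i * esum x' r.
Proof.
move=> xi xl.
pose h (m : {ffun 'I_n -> nat}) : {ffun 'I_n -> nat} := [ffun l => ((l == i) + m l)%N].
have hI : injective h.
  by move=> m m' /ffunP mm; apply/ffunP => l; have := mm l; rewrite !ffunE => /addnI.
pose G m := esum_term x r.+1 m - esum_term x' r.+1 m.
have Gh m : G (h m) = x i * esum_term x' r m.
  rewrite /G /esum_term.
  have -> : (\sum_l h m l = (\sum_l m l).+1)%N.
    rewrite (eq_bigr (fun l => ((l == i) + m l)%N)) => [|l _]; last by rewrite ffunE.
    by rewrite big_split /= -big_mkcond /= big_pred1_eq add1n.
  rewrite eqSS; case: eqP => _; last by rewrite subrr mulr0.
  rewrite (bigD1 i)//= [X in _ - X](bigD1 i)//= [in RHS](bigD1 i)//=.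
  have -> : \prod_(l < n | l != i) eulerc q (x' l) (h m l) =
      \prod_(l < n | l != i) eulerc q (x l) (m l).
    by apply: eq_bigr => l li; rewrite ffunE (negPf li) xl.
  have -> : \prod_(l < n | l != i) eulerc q (x l) (h m l) =
      \prod_(l < n | l != i) eulerc q (x l) (m l).
    by apply: eq_bigr => l li; rewrite ffunE (negPf li).
  have -> : \prod_(l < n | l != i) eulerc q (x' l) (m l) =
      \prod_(l < n | l != i) eulerc q (x l) (m l).
    by apply: eq_bigr => l li; rewrite xl.
  rewrite ffunE eqxx add1n -mulrBl eulerc_rec// xi.
  by rewrite [X in (X - _) * _]addrC addrK [RHS]mulrA.
have G0 m : (forall m', h m' != m) -> G m = 0.
  move=> mh; rewrite /G /esum_term; case: ifP => _; last by rewrite subrr.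
  have mi : m i = 0%N.
    apply/eqP; apply: contraT => mi; have /eqP[] := mh [ffun l => (m l - (l == i))%N].
    apply/ffunP => l; rewrite !ffunE; case: eqP => [->|_] /=; last by rewrite subn0.
    by rewrite subnKC// lt0n.
  rewrite (bigD1 i)//= [X in _ - X](bigD1 i)//= mi !eulerc0 !mul1r.
  by apply/eqP; rewrite subr_eq0; apply/eqP/eq_bigr => l li; rewrite xl.
have sm := @lsmall_esum x r.+1; have sm' := @lsmall_esum x' r.+1.
have GE : lsum G = esum x r.+1 - esum x' r.+1.
  rewrite /G; under eq_lsum do rewrite -mulN1r.
  by rewrite lsumD ?lsumZ ?mulN1r//; exact: lsmallZ.
have Gs : lsmall (G \o h).
  by have := lsmallZ (x i) (@lsmall_esum x' r); apply: eq_lsmall => m; rewrite /= Gh.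
rewrite -GE (lsum_reindex hI Gs G0) -lsumZ; last exact: lsmall_esum.
exact: eq_lsum.
Qed.

End Elementary.

Section Theta.
Variables (K : comUnitRingType) (n : nat).

Let qS_unit m : 1 - 'q ^+ m.+1 \is a @GRing.unit (laurent K).
Proof. by apply: lunit1B; apply: expS_bounded; exact: q_bounded. Qed.

(** Equal increments make f - g a constant d, and the wrap-around forces d = q^(r+1) d, hence d =
    0. *)
Let cyclic_eq (f g : nat -> laurent K) r :
  (forall i, (i < n)%N -> f i.+1 - f i = g i.+1 - g i) ->
  (f 0%N = 'q ^+ r.+1 * f n /\ g 0%N = 'q ^+ r.+1 * g n \/
   f n = 'q ^+ r.+1 * f 0%N /\ g n = 'q ^+ r.+1 * g 0%N) ->
  forall i, (i <= n)%N -> f i = g i.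
Proof.
move=> fgS fgw; pose d i := f i - g i.
have dc i : (i <= n)%N -> d i = d 0%N.
  elim: i => // i IHi ltin; rewrite -(IHi (ltnW ltin)) /d.
  by apply/eqP; rewrite -subr_eq0 opprD addrACA -opprD fgS// subrr.
move=> i /dc di; apply/eqP; rewrite -subr_eq0 -/(d i) di; apply/eqP.
apply: (mulrI (qS_unit r)); rewrite mulr0 mulrBl mul1r.
suff {1}-> : d 0%N = 'q ^+ r.+1 * d 0%N by rewrite subrr.
have dn := dc n (leqnn n); case: fgw => -[E1 E2].
  by rewrite -{2}dn /d mulrBr -E1 -E2.
by rewrite -{1}dn /d mulrBr -E1 -E2.
Qed.

(** By induction on r both sides have the same increments in [i0] and the same wrap-around, so
    [cyclic_eq] applies. *)
Lemma row_a_esum (A : nat -> laurent K) r i0 : (i0 <= n)%N ->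
  row_a n A r i0 = esum (fun l : 'I_n => A l * 'q ^+ (i0 <= l)%N) r.
Proof.
pose S r i0 := esum (fun l : 'I_n => A l * 'q ^+ (i0 <= l)%N) r.
rewrite -/(S r i0).
have Sd s i : (i < n)%N -> S s.+1 i.+1 - S s.+1 i = A i * S s i.
  move=> ltin; rewrite /S (@esum_diff _ _ _ (fun l => A l * 'q ^+ (i <= l)%N) _ (Ordinal ltin)).
  - by rewrite /= ltnn expr0 mulr1.
  - by rewrite /= ltnn leqnn expr0 expr1 mulr1.
  - move=> l /eqP li; rewrite [(i <= l)%N]leq_eqVlt; case: eqP => //= il.
    by case: li; apply: val_inj.
have Sw s : S s 0%N = 'q ^+ s * S s n.
  have E : (fun l : 'I_n => A l * 'q ^+ (0 <= l)%N) =
      (fun l => A l * 'q ^+ (n <= l)%N * 'q).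
    by apply/funext => l; rewrite leq0n leqNgt ltn_ord expr0 expr1 mulr1.
  by rewrite /S E esum_wrap.
elim: r i0 => [|r IH] i0 i0n; first by rewrite /S esum0.
apply: (@cyclic_eq (row_a n A r.+1) (S r.+1) r _ _ _ i0n).
  by move=> i ltin; rewrite (row_a_diff A r ltin) (Sd r i ltin) (IH i (ltnW ltin)).
by left; split; [exact: row_a_wrap | exact: Sw].
Qed.

Lemma row_b_esum (B : nat -> laurent K) r j0 : (j0 <= n)%N ->
  row_b n B r j0 = esum (fun l : 'I_n => B l * 'q ^+ (l < j0)%N) r.
Proof.
pose S r j0 := esum (fun l : 'I_n => B l * 'q ^+ (l < j0)%N) r.
rewrite -/(S r j0).
have Sd s k : (k < n)%N -> S s.+1 k - S s.+1 k.+1 = B k * S s k.+1.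
  move=> ltkn; rewrite /S (@esum_diff _ _ _ (fun l => B l * 'q ^+ (l < k.+1)%N) _ (Ordinal ltkn)).
  - by rewrite /= ltnn expr0 mulr1.
  - by rewrite /= ltnn leqnn expr0 expr1 mulr1.
  - move=> l /eqP li; rewrite ltnS [(l <= k)%N]leq_eqVlt; case: eqP => //= il.
    by case: li; apply: val_inj.
have Sw s : S s n = 'q ^+ s * S s 0%N.
  have E : (fun l : 'I_n => B l * 'q ^+ (l < n)%N) =
      (fun l => B l * 'q ^+ (l < 0)%N * 'q).
    by apply/funext => l; rewrite ltn_ord ltn0 expr0 expr1 mulr1.
  by rewrite /S E esum_wrap.
elim: r j0 => [|r IH] j0 j0n; first by rewrite /S esum0.
apply: (@cyclic_eq (row_b n B r.+1) (S r.+1) r _ _ _ j0n).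
  move=> i ltin; apply: oppr_inj; rewrite !opprB.
  by rewrite (row_b_diff B r ltin) (Sd r i ltin) (IH i.+1 ltin).
by right; split; [exact: row_b_wrap | exact: Sw].
Qed.

End Theta.

(** * The Frobenius series as a sum over exponent differences *)

Section FrobeniusTheta.
Variables (K : comUnitRingType) (n : nat) (a : nat -> K).
Hypothesis a_unit : forall i, (i < n)%N -> a i \is a GRing.unit.

Let A i : laurent K := (a i)%:L.
Let B i : laurent K := ((a i)^-1)%:L.

Lemma Fseries_esum : colour_series a (@Fcount n) =
  lsum (fun r => 'q ^+ r * (esum (fun l : 'I_n => A l) r * esum (fun l : 'I_n => B l) r)).
Proof.
rewrite (Fseries_rows a_unit); apply: eq_lsum => r.
rewrite (row_a_esum _ r (leqnn n)) (row_b_esum _ r (leq0n n)).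
have -> : (fun l : 'I_n => (a l)%:L * 'q ^+ (n <= l)%N) = (fun l : 'I_n => A l).
  by apply/funext => l; rewrite leqNgt ltn_ord mulr1.
by have -> : (fun l : 'I_n => ((a l)^-1)%:L * 'q ^+ (l < 0)%N) = (fun l : 'I_n => B l)
  by apply/funext => l; rewrite ltn0 mulr1.
Qed.

(* the colours of the two rows contribute the pairs (m l).1, (m l).2 *)
Let F (m : {ffun 'I_n -> nat * nat}) : laurent K :=
  if (\sum_l (m l).1 == \sum_l (m l).2)%N then
    \prod_(l < n) (eulerc 'q ('q * A l) (m l).1 * eulerc 'q (B l) (m l).2) else 0.

Let euler0 (x : laurent K) m : lbounded 0 x -> lbounded 0 (eulerc 'q x m).
Proof.
move=> x0; apply: lboundedW (eulerc_bounded (m := m) (@q_bounded K) x0); lia.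
Qed.

Let q_eulerc x m : eulerc 'q ('q * x) m = 'q ^+ m * eulerc 'q x m :> laurent K.
Proof.
rewrite /eulerc exprMn; move: (_^-1) ('q ^+ 'C(m, 2)) ('q ^+ m) => D c r.
by rewrite !mulrA (mulrC c).
Qed.

Let P := ({ffun 'I_n -> nat} * {ffun 'I_n -> nat})%type.
(** The family with two separate exponent vectors, as the product of two [esum] produces it. *)
Let FP (p : P) : laurent K :=
  if (\sum_l p.1 l == \sum_l p.2 l)%N then
    'q ^+ (\sum_l p.1 l)%N *
    (\prod_(l < n) eulerc 'q (A l) (p.1 l) * \prod_(l < n) eulerc 'q (B l) (p.2 l)) else 0.

Let FPs : lsmall FP.
Proof.
apply: (lsmallI (A := fun M => ([set m : {ffun 'I_n -> nat} | (\sum_l m l <= `|M|)%N] `*`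
   [set m : {ffun 'I_n -> nat} | (\sum_l m l <= `|M|)%N])%classic)) => [M|M [m m'] /= mM].
  by apply: finite_setX; exact: finite_ffun_sum.
rewrite /FP /=; case: eqP => // mm.
have b0 (x : 'I_n -> laurent K) (k : {ffun 'I_n -> nat}) :
    (forall l, lbounded 0 (x l)) -> lbounded 0 (\prod_l eulerc 'q (x l) (k l)).
  move=> x0; have := @lbounded_prod K _ (index_enum 'I_n) xpredT
    (fun l => eulerc 'q (x l) (k l)) (fun=> 0) (fun l _ => @euler0 _ (k l) (x0 l)).
  by rewrite big1.
have c0 (c : K) : lbounded 0 c%:L by exact: lmono_bounded.
have := lboundedM (lboundedXn (m := (\sum_l m l)%N) (@q_bounded K))
  (lboundedM (b0 A m (fun l => c0 _)) (b0 B m' (fun l => c0 _))).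
apply: lboundedW; rewrite !addr0 leNgt; apply/negP => mlt; apply: mM.
have mM : (\sum_l m l <= `|M|)%N by lia.
by split=> /=; [exact: mM | rewrite -mm; exact: mM].
Qed.

Let hP (m : {ffun 'I_n -> nat * nat}) : P := ([ffun l => (m l).1], [ffun l => (m l).2]).

Let hPI : injective hP.
Proof.
move=> m m' /(can_inj (g := fun p : P => [ffun l => (p.1 l, p.2 l)])); apply.
by move=> k; apply/ffunP => l; rewrite !ffunE; case: (k l).
Qed.

Let FPh m : FP (hP m) = F m.
Proof.
rewrite /FP /F /hP /=.
have -> : (\sum_l [ffun l => (m l).1] l = \sum_l (m l).1)%N.
  by apply: eq_bigr => l _; rewrite ffunE.
have -> : (\sum_l [ffun l => (m l).2] l = \sum_l (m l).2)%N.
  by apply: eq_bigr => l _; rewrite ffunE.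
case: ifP => // _; rewrite -prodrXr -!big_split /=; apply: eq_bigr => l _.
by rewrite !ffunE q_eulerc mulrA.
Qed.

Let Fs : lsmall F.
Proof.
by have := lsmall_comp hPI FPs; apply: eq_lsmall => m; rewrite /= FPh.
Qed.

(** Grouping by the differences k_l of the exponents of each colour, equal row lengths mean that the
    k_l sum to 0, and for fixed k the sum factors over the colours. *)
Lemma Fseries_theta : colour_series a (@Fcount n) =
  lsum (fun k : {ffun 'I_n -> int} =>
    if \sum_l k l == 0 then \prod_(l < n) (jterm 1 (a l) 1 (k l) / qpoch 'q 'q) else 0).
Proof.
rewrite Fseries_esum; transitivity (lsum FP).
  rewrite (lsum_fibre (fun p : P => (\sum_l p.1 l)%N) FPs); apply: eq_lsum => r.
  rewrite lsumM; [|exact: lsmall_esum..].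
  rewrite -lsumZ; last by apply: lsmallM; exact: lsmall_esum.
  apply: eq_lsum => -[m m'] /=; rewrite /esum_term /FP /=.
  case: eqP => [->|_]; last by rewrite mul0r mulr0.
  by rewrite eq_sym; case: ifP => _; rewrite ?mulr0.
rewrite (lsum_reindex hPI (lsmall_comp hPI FPs)); last first.
  move=> p /(_ [ffun l => (p.1 l, p.2 l)])/eqP[]; case: p => m m'.
  by congr (_, _); apply/ffunP => l; rewrite !ffunE.
transitivity (lsum F); first by apply: eq_lsum => m /=; rewrite FPh.
pose h (m : {ffun 'I_n -> nat * nat}) : {ffun 'I_n -> int} :=
  [ffun l => (m l).1%:Z - (m l).2%:Z].
rewrite (lsum_fibre h Fs).
apply: eq_lsum => k.
pose g (l : 'I_n) (p : nat * nat) : laurent K :=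
  if p.1%:Z - p.2%:Z == k l then eulerc 'q ('q * A l) p.1 * eulerc 'q (B l) p.2 else 0.
have gs l : lsmall (g l).
  by apply: lsmall_if; apply: lsmallM; apply: lsmall_eulerc; exact: q_bounded.
(* The length condition depends on k alone and becomes a scalar factor; the rest is a product over
   colours, ready for [lprod_lsum]. *)
transitivity (lsum (fun m : {ffun 'I_n -> nat * nat} =>
    (if \sum_l k l == 0 then 1 else 0) * \prod_l g l (m l))).
  apply: eq_lsum => m; case: eqP => [kE|kN]; last first.
    have [l kl] : exists l, (m l).1%:Z - (m l).2%:Z != k l.
      apply/existsP; rewrite -negb_forall; apply/forallP => ml; apply: kN.
      by apply/ffunP => l; rewrite ffunE; exact/eqP.
    by rewrite [X in _ * X](bigD1 l)//= {1}/g (negPf kl) mul0r mulr0.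
  have -> : (\sum_l k l == 0) = (\sum_l (m l).1 == \sum_l (m l).2)%N.
    rewrite -kE (eq_bigr (fun l => (m l).1%:Z - (m l).2%:Z)) => [|l _]; last by rewrite ffunE.
    by rewrite sumrB subr_eq0 -!(big_morph Posz PoszD (erefl 0%:Z)) eqz_nat.
  rewrite /F; case: ifP => _; rewrite ?mul0r// mul1r; apply: eq_bigr => l _.
  by rewrite /g -kE /h ffunE eqxx.
have [gps gpE] := lprod_lsum gs.
rewrite lsumZ// -gpE; case: eqP => _; rewrite ?mul0r// mul1r; apply: eq_bigr => l _.
have AE : 'q * A l = lmono (a l) 1 by rewrite lmonoM mul1r addr0.
(* Here z = a_l q and p = q, so that p/z is the inverse of a_l. *)
have := euler_diag (N := 1) isT 1 (a_unit (ltn_ord l)) (k l).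
by rewrite expr1 subrr /g AE.
Qed.

End FrobeniusTheta.

Lemma sub1S n (s : 'I_n.-1 -> int) (j : 'I_n.-1) : sub1 s j.+1 = s j.
Proof. by rewrite /sub1 /= valK. Qed.

Lemma sub1_last n (s : 'I_n.-1 -> int) : sub1 s n = 0.
Proof. by rewrite /sub1 insubF ?ltnn. Qed.

(* [s_1, ..., s_(n-1)] extended by [s_0 = s_n = 0] *)
Definition sub0 n (s : 'I_n.-1 -> int) (j : nat) : int := if j is 0%N then 0 else sub1 s j.

Lemma sub0_last n (s : 'I_n.-1 -> int) : sub0 s n = 0.
Proof. by case: n s => // n s; exact: sub1_last. Qed.

(** * The theta sum over s_1, ..., s_(n-1) *)

Section FirstFormula.
Variables (K : comUnitRingType) (n : nat) (a : nat -> K).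
Hypothesis n_gt0 : (0 < n)%N.
Hypothesis a_unit : forall i, (i < n)%N -> a i \is a GRing.unit.

Definition theta_term (s : {ffun 'I_n.-1 -> int}) : laurent K :=
  (a 0%N)%:L ^ (- sub1 s 1%N) *
  \prod_(1 <= i < n) ((a i)%:L ^ (sub1 s i - sub1 s i.+1) *
                      'q ^ (sub1 s i * (sub1 s i - sub1 s i.+1))).

Lemma theta_termE s : theta_term s =
  lmono (\prod_(0 <= i < n) a i ^ (sub0 s i - sub0 s i.+1))
        (\sum_(1 <= i < n) sub1 s i * (sub1 s i - sub1 s i.+1)).
Proof.
rewrite /theta_term (eq_big_nat _ _ (F2 := fun i =>
    lmono (a i ^ (sub1 s i - sub1 s i.+1)) (sub1 s i * (sub1 s i - sub1 s i.+1)))).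
  rewrite -rmorphXz ?a_unit// lmono_prod lmonoM add0r; congr lmono.
  rewrite [RHS]big_ltn//= sub0r; congr (_ * _).
  by apply: eq_big_nat => -[].
move=> i /andP[_ ltin].
by rewrite -rmorphXz ?a_unit// lqXz lmonoM mulr1 add0r.
Qed.

(** The exponents of the a_i. As s_0 = s_n = 0, this identifies Z^(n-1) with the integer vectors of
    sum 0; [discharge] inverts it by partial sums. *)
Definition charge (s : {ffun 'I_n.-1 -> int}) : {ffun 'I_n -> int} :=
  [ffun i : 'I_n => sub0 s i - sub0 s i.+1].

Let charge_sum s m : (m <= n)%N ->
  \sum_(i < n | (i < m)%N) charge s i = - sub0 s m.
Proof.
move=> mn; rewrite (eq_bigr (fun i : 'I_n => sub0 s i - sub0 s i.+1)); last first.
  by move=> i _; rewrite ffunE.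
rewrite -(big_ord_widen n (fun i => sub0 s i - sub0 s i.+1) mn).
by elim: m {mn} => [|m IH]; rewrite ?big_ord0 ?oppr0// big_ord_recr /= IH addKr.
Qed.

Lemma charge_sum0 s : \sum_i charge s i = 0.
Proof.
rewrite (eq_bigl (fun i : 'I_n => (i < n)%N)) => [|i]; last by rewrite ltn_ord.
by rewrite charge_sum// sub0_last oppr0.
Qed.

Let discharge (k : {ffun 'I_n -> int}) : {ffun 'I_n.-1 -> int} :=
  [ffun j : 'I_n.-1 => - \sum_(i < n | (i < j.+1)%N) k i].

Let chargeK : cancel charge discharge.
Proof.
move=> s; apply/ffunP => j; rewrite ffunE charge_sum ?opprK /=; first exact: sub1S.
by have := ltn_ord j; lia.
Qed.

Let dischargeK (k : {ffun 'I_n -> int}) : \sum_i k i = 0 -> charge (discharge k) = k.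
Proof.
move=> k0; have dE m : (m <= n)%N ->
    sub0 (discharge k) m = - \sum_(i < n | (i < m)%N) k i.
  case: m => [|m] mn /=; first by rewrite big1 ?oppr0.
  have [mn'|mn'] := ltnP m n.-1.
    by rewrite (@sub1S n (discharge k) (Ordinal mn')) ffunE.
  have -> : m.+1 = n by lia.
  rewrite sub1_last (eq_bigl xpredT) ?k0 ?oppr0// => i.
  by rewrite ltn_ord.
apply/ffunP => i; rewrite ffunE !dE ?(ltnW (ltn_ord i))//.
rewrite opprK [X in _ + X](bigD1 i) /= ?leqnn// [X in _ + X]addrC addrA.
rewrite [X in _ + X + _](eq_bigl (fun j : 'I_n => (j < i)%N)) ?addNr ?add0r// => j.
by rewrite ltnS [in RHS]ltn_neqAle andbC.
Qed.

Lemma theta_term_charge s :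
  theta_term s = \prod_(l < n) jterm 1 (a l) 1 (charge s l).
Proof.
rewrite theta_termE /jterm lmono_prod big_mkord; congr lmono.
  by apply: eq_bigr => i _; rewrite ffunE.
rewrite (eq_bigr (fun i : 'I_n => (sub0 s i - sub0 s i.+1) + tri (sub0 s i - sub0 s i.+1))).
  2: by move=> i _; rewrite ffunE !mul1r.
rewrite -(big_mkord xpredT (fun i => (sub0 s i - sub0 s i.+1) + tri (sub0 s i - sub0 s i.+1))).
(* Doubled to clear the halves in [tri]. The two exponents differ by a telescoping term that
   vanishes at m = n because s_n = 0. *)
have E m : 2 * \sum_(0 <= i < m) ((sub0 s i - sub0 s i.+1) + tri (sub0 s i - sub0 s i.+1)) =
    2 * \sum_(0 <= i < m) (sub0 s i * (sub0 s i - sub0 s i.+1)) +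
    sub0 s m ^+ 2 - sub0 s m.
  elim: m => [|m IH]; first by rewrite !big_geq.
  rewrite !big_nat_recr// !mulrDr {}IH.
  have := tri_double (sub0 s m - sub0 s m.+1).
  set t := tri _; set S := \sum_(0 <= i < m) _; rewrite mulrC => ->.
  by move: (sub0 s m) (sub0 s m.+1) S => x y S; ring.
have := E n; rewrite sub0_last expr0n subr0 addr0 => {}E.
have {}E : \sum_(0 <= i < n) ((sub0 s i - sub0 s i.+1) + tri (sub0 s i - sub0 s i.+1)) =
    \sum_(0 <= i < n) (sub0 s i * (sub0 s i - sub0 s i.+1)) by lia.
rewrite E [RHS]big_ltn//= mul0r add0r; apply: eq_big_nat => -[]//.
Qed.

Lemma lsmall_theta : lsmall theta_term.
Proof.
have [sm _] := @lprod_lsum K _ n (fun l => jterm 1 (a l) 1)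
  (fun l => lsmall_jterm (N := 1) isT 1 (a_unit (ltn_ord l))).
have := lsmall_comp (can_inj chargeK) sm; apply: eq_lsmall => s.
by rewrite /= theta_term_charge.
Qed.

Lemma Fseries_thetaE :
  colour_series a (@Fcount n) = (qpoch 'q 'q ^+ n)^-1 * lsum theta_term.
Proof.
rewrite Fseries_theta// -lsumZ; last exact: lsmall_theta.
set F := (X in lsum X = _).
have Fc : F \o charge = fun s => (qpoch 'q 'q ^+ n)^-1 * theta_term s.
  apply/funext => s; rewrite /F /= charge_sum0 eqxx theta_term_charge.
  by rewrite big_split /= prodr_const card_ord exprVn mulrC.
rewrite (lsum_reindex (h := charge)) ?Fc//.
- exact: can_inj chargeK.
- by apply: lsmallZ; exact: lsmall_theta.
- move=> k kN; rewrite /F; case: eqP => // k0.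
  by have /eqP[] := kN (discharge k); exact: dischargeK.
Qed.

End FirstFormula.

(** * The product formula *)

Lemma sub1_ffun n (F : nat -> int) k : (0 < k < n)%N ->
  sub1 [ffun j : 'I_n.-1 => F j.+1] k = F k.
Proof.
case: k => // k /= kn; have kn' : (k < n.-1)%N by lia.
by rewrite (@sub1S n _ (Ordinal kn')) ffunE.
Qed.

Lemma sub1_eq n (s t : {ffun 'I_n.-1 -> int}) :
  (forall k, (0 < k < n)%N -> sub1 s k = sub1 t k) -> s = t.
Proof.
move=> st; apply/ffunP => j; rewrite -!sub1S; apply: st.
by have := ltn_ord j; lia.
Qed.

Lemma exprzM (R : comUnitRingType) (x y : R) (k : int) :
  x \is a GRing.unit -> y \is a GRing.unit -> (x * y) ^ k = x ^ k * y ^ k.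
Proof. by move=> xU yU; rewrite exprMz_comm//; exact: mulrC. Qed.

(** * Splitting the exponents of q and of the a_i *)

Section Exponents.
Variables (n : nat) (r m : nat -> int).
Hypotheses (n_gt0 : (0 < n)%N) (mn : m n = 0).
Let s i := r i + i%:Z * m i.
Let x i := m i - m i.+1.
Let e i := (i * i.+1)./2%:Z + i.+1%:Z * r i - i%:Z * r i.+1.

Lemma half_mulS i : (i * i.+1)./2%:Z * 2 = i%:Z * (i%:Z + 1).
Proof.
have := odd_double_half (i * i.+1); rewrite oddM /= andbN add0n -muln2 => h.
by rewrite -[2]/(2%:Z) -PoszM h PoszM -addn1 PoszD.
Qed.

Lemma quad_split :
  \sum_(1 <= i < n) s i * (s i - s i.+1) =
  \sum_(1 <= i < n) r i * (r i - r i.+1) +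
  \sum_(1 <= i < n) (e i * x i + (i * i.+1)%:Z * tri (x i)).
Proof.
(* The telescoping correction that removes the cross terms in m_i and m_(i+1). It vanishes at i = 1
   through the factor i - 1 and at i = n through m_n = 0. *)
pose T i : int := i%:Z * (i%:Z - 1) * m i ^+ 2 + 2 * (i%:Z - 1) * r i * m i.
have E i : 2 * (s i * (s i - s i.+1)) = 2 * (r i * (r i - r i.+1)) +
    2 * (e i * x i + (i * i.+1)%:Z * tri (x i)) - (T i.+1 - T i).
  have -> : 2 * (e i * x i + (i * i.+1)%:Z * tri (x i)) =
      ((i * i.+1)./2%:Z * 2 + 2 * (i.+1%:Z * r i - i%:Z * r i.+1)) * x i +
      (i * i.+1)%:Z * (tri (x i) * 2).
    by rewrite /e; move: (tri _) ((i * i.+1)./2%:Z) (i * i.+1)%:Z => t h N; ring.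
  by rewrite half_mulS tri_double PoszM intS /T /s /x intS; ring.
suff E2 : 2 * \sum_(1 <= i < n) s i * (s i - s i.+1) =
  2 * (\sum_(1 <= i < n) r i * (r i - r i.+1) +
  \sum_(1 <= i < n) (e i * x i + (i * i.+1)%:Z * tri (x i))) by lia.
rewrite mulrDr !mulr_sumr (eq_bigr _ (fun i _ => E i)) sumrB big_split /=.
rewrite telescope_sumr// /T mn; ring.
Qed.

Variables (K : comUnitRingType) (a : nat -> K).
Hypothesis a_unit : forall i, (i < n)%N -> a i \is a GRing.unit.
Hypothesis r1 : r 1%N = 0.

Let s0 i := if i is 0%N then 0 else s i.

Let u i := \prod_(0 <= l < i) (a i / a l).

Lemma ratio_unit i : (i < n)%N -> u i \is a GRing.unit.
Proof.
move=> ltin; rewrite /u big_nat; apply: rpred_prod => l /andP[_ li].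
by rewrite unitrM unitrV !a_unit//; apply: ltn_trans ltin.
Qed.

Lemma weight_split :
  \prod_(0 <= i < n) a i ^ (s0 i - s0 i.+1) =
  \prod_(1 <= i < n) a i ^ (r i - r i.+1) * \prod_(1 <= i < n) u i ^ (x i).
Proof.
pose P k := \prod_(0 <= l < k) a l.
have PU k : (k <= n)%N -> P k \is a GRing.unit.
  move=> kn; rewrite /P big_nat; apply: rpred_prod => l /andP[_ lk].
  by apply: a_unit; exact: leq_trans kn.
(* Induction invariant: after k factors the discrepancy is (a_0 ... a_(k-1))^(-m_k), which
   disappears at k = n. The case k = 1 uses r_1 = 0. *)
have main k : (0 < k <= n)%N -> \prod_(0 <= i < k) a i ^ (s0 i - s0 i.+1) =
    \prod_(1 <= i < k) a i ^ (r i - r i.+1) * \prod_(1 <= i < k) u i ^ (x i) *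
    P k ^ (- m k).
  case: k => // k /=; elim: k => [|k IH] kn.
    rewrite !big_nat1 !(big_geq (leqnn 1)) /P big_nat1 !mul1r /s r1.
    by congr (_ ^ _); rewrite /=; ring.
  rewrite !(big_nat_recr k.+1)//= IH; last exact: ltnW.
  have aU := a_unit kn; have kU := PU k.+1 (ltnW kn).
  have -> : u k.+1 = a k.+1 ^ (k.+1%:Z) * P k.+1 ^ (-1).
    rewrite /u big_split /= prodr_const_nat subn0 -exprnP exprN1; congr (_ * _).
    rewrite /P !big_nat prodrV => [//|l /andP[_ lk]].
    by apply: a_unit; exact: ltn_trans kn.
  have -> : P k.+2 = a k.+1 * P k.+1 by rewrite /P big_nat_recr//= mulrC.
  rewrite !exprzM ?unitrX ?unitrV// -?exprnP ?unitrX//.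
  rewrite exprnP !exprz_exp.
  have -> : a k.+1 ^ (s0 k.+1 - s0 k.+2) =
      a k.+1 ^ (r k.+1 - r k.+2) * a k.+1 ^ (k.+1%:Z * x k.+1) * a k.+1 ^ (- m k.+2).
    by rewrite -!exprzDr//; congr (_ ^ _); rewrite /s0 /s /x [k.+2%:Z]intS; ring.
  have -> : P k.+1 ^ (- m k.+1) = P k.+1 ^ (-1 * x k.+1) * P k.+1 ^ (- m k.+2).
    by rewrite -exprzDr//; congr (_ ^ _); rewrite /x; ring.
  by move: (a k.+1 ^ _) (a k.+1 ^ _) (a k.+1 ^ _) (P k.+1 ^ _) (P k.+1 ^ _) => *; ring.
by rewrite main ?n_gt0 ?leqnn// mn oppr0 expr0z mulr1.
Qed.

End Exponents.

(** * Summation over residue classes and triple products *)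

Section SecondFormula.
Variables (K : comUnitRingType) (n : nat) (a : nat -> K).
Hypothesis n_gt0 : (0 < n)%N.
Hypothesis a_unit : forall i, (i < n)%N -> a i \is a GRing.unit.
Notation zvec := {ffun 'I_n.-1 -> int}.
Notation rvec := {ffun 'I_n.-1 -> 'I_n}.

Let rr (r : rvec) : nat -> int := sub1 (fun j => (r j)%:Z).
Let mm (x : zvec) (i : nat) : int := \sum_(i <= k < n) sub1 x k.

Let mm_last x : mm x n = 0.
Proof. by rewrite /mm big_geq. Qed.

Let mm_diff x i : (i < n)%N -> mm x i - mm x i.+1 = sub1 x i.
Proof. by move=> ltin; rewrite /mm (big_ltn ltin) addrK. Qed.

(* s_j = r_j + j (x_j + ... + x_(n-1)) *)
Definition recombine (r : rvec) (x : zvec) : zvec :=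
  [ffun j : 'I_n.-1 => rr r j.+1 + j.+1%:Z * mm x j.+1].

Lemma recombineE r x i : (0 < i <= n)%N ->
  sub1 (recombine r x) i = rr r i + i%:Z * mm x i.
Proof.
move=> /andP[i0]; rewrite leq_eqVlt => /predU1P[->|ltin].
  by rewrite mm_last mulr0 addr0 /rr !sub1_last.
by rewrite /recombine (@sub1_ffun n (fun i => rr r i + i%:Z * mm x i)) ?i0.
Qed.

(** Indices start from 0, so the modulus is j + 1; the remainder is below n and the default of
    [insubd] never occurs. *)
Definition residue (s : zvec) : rvec :=
  [ffun j : 'I_n.-1 => insubd (Ordinal n_gt0) `|(s j %% j.+1%:Z)%Z|%N].

Lemma residueE s j : (residue s j)%:Z = (s j %% j.+1%:Z)%Z.
Proof.
rewrite ffunE val_insubd.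
have m0 : 0 <= (s j %% j.+1%:Z)%Z by rewrite modz_ge0.
have m1 : (s j %% j.+1%:Z)%Z < j.+1%:Z by rewrite ltz_pmod.
by rewrite ifT; have := ltn_ord j; lia.
Qed.

Lemma residue_le s j : (residue s j <= j)%N.
Proof. by have := residueE s j; have := @ltz_pmod (s j) j.+1%:Z isT; lia. Qed.

(** This recovers x_i + ... + x_(n-1) from s. *)
Let quo (r : rvec) (s : zvec) (i : nat) : int := ((sub1 s i - rr r i) %/ i%:Z)%Z.

Let decombine (r : rvec) (s : zvec) : zvec :=
  [ffun j : 'I_n.-1 => quo r s j.+1 - quo r s j.+2].

Let recombineK r : cancel (recombine r) (decombine r).
Proof.
move=> x; apply: sub1_eq => k /andP[k0 kn].
rewrite /decombine (@sub1_ffun n (fun i => quo r _ i - quo r _ i.+1)) ?k0//.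
have qE i : (0 < i <= n)%N -> quo r (recombine r x) i = mm x i.
  move=> i0n; rewrite /quo recombineE// [rr r i + _]addrC addrK mulrC mulzK//.
  by case/andP: i0n; lia.
by rewrite !qE ?mm_diff//; lia.
Qed.

(** The divisions are exact because r holds the residues of s, and the differences of the quotients
    telescope to the last quotient, which is 0. *)
Let decombineK r s : residue s = r -> recombine r (decombine r s) = s.
Proof.
move=> sr; apply: sub1_eq => k /andP[k0 kn].
rewrite recombineE; last by rewrite k0 ltnW.
have -> : mm (decombine r s) k = quo r s k.
  rewrite /mm big_nat (eq_bigr (fun i => - (quo r s i.+1 - quo r s i))); last first.
    move=> i /andP[ki ltin].
    rewrite /decombine (@sub1_ffun n (fun i => quo r _ i - quo r _ i.+1)) ?opprB//.
    by rewrite ltin (leq_trans k0).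
  rewrite -big_nat sumrN telescope_sumr ?opprB; last exact: ltnW.
  by rewrite [quo r s n]/quo /rr !sub1_last subrr div0z subr0.
case: k k0 kn => // k _ kn; have kn' : (k < n.-1)%N by lia.
rewrite /quo /rr -[k.+1]/((Ordinal kn').+1) !sub1S -sr residueE /=.
rewrite {2}(divz_eq (s (Ordinal kn')) k.+1%:Z) addrK mulzK// mulrC addrC.
exact/esym/divz_eq.
Qed.

Let valid (r : rvec) := [forall j, (r j <= j)%N].

Lemma residue_recombine r x : valid r -> residue (recombine r x) = r.
Proof.
move=> /forallP vr; apply/ffunP => j; apply: val_inj; apply/eqP.
rewrite -eqz_nat residueE ffunE /rr (sub1S (fun j => (r j)%:Z)) mulrC addrC modzMDl.
by rewrite modz_small//; have := vr j; lia.
Qed.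

(** The sum is split by the residues of s_j modulo j. Each admissible residue vector has its class
    parametrized by [recombine]; the other classes are empty. *)
Lemma lsum_residue (F : zvec -> laurent K) : lsmall F ->
  lsum F = \sum_(r | valid r) lsum (fun x => F (recombine r x)).
Proof.
move=> Fs; rewrite (lsum_fibre residue Fs) lsum_fin [RHS]big_mkcond.
apply: eq_bigr => r _; case: ifP => vr; last first.
  rewrite -[RHS](lsum0 K zvec); apply: eq_lsum => s; case: eqP => // sr.
  by move/negP: vr; case; rewrite -sr; apply/forallP => j; exact: residue_le.
rewrite (lsum_reindex (can_inj (recombineK r))).
- by apply: eq_lsum => x /=; rewrite residue_recombine// eqxx.
- have := lsmall_comp (can_inj (recombineK r)) Fs; apply: eq_lsmall => x /=.
  by rewrite residue_recombine// eqxx.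
- move=> s sN; case: eqP => // sr; have /eqP[] := sN (decombine r s).
  exact: decombineK.
Qed.

Let ex (r : rvec) (i : nat) : int :=
  (i * i.+1)./2%:Z + i.+1%:Z * rr r i - i%:Z * rr r i.+1.
Let uu i : K := \prod_(0 <= l < i) (a i / a l).

Let head r : laurent K := \prod_(1 <= i < n)
  ((a i)%:L ^ (rr r i - rr r i.+1) * 'q ^ (rr r i * (rr r i - rr r i.+1))).

Let head_mono r : head r = lmono (\prod_(1 <= i < n) a i ^ (rr r i - rr r i.+1))
  (\sum_(1 <= i < n) rr r i * (rr r i - rr r i.+1)).
Proof.
rewrite /head -lmono_prod; apply: eq_big_nat => i /andP[_ ltin].
by rewrite -rmorphXz ?a_unit// lqXz lmonoM mulr1 add0r.
Qed.

Lemma theta_term_recombine r x : valid r ->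
  theta_term a (recombine r x) =
  head r * \prod_(1 <= i < n) jterm (i * i.+1) (uu i) (ex r i) (sub1 x i).
Proof.
move=> /forallP vr; rewrite theta_termE// head_mono /jterm lmono_prod lmonoM.
(* A residue modulo 1, or the default value r_n = 0 when n = 1. *)
have r1 : rr r 1 = 0.
  have [n1|n1] := leqP n.-1 0; first by rewrite /rr /sub1 insubF//; lia.
  rewrite /rr -[1%N]/((Ordinal n1).+1) (sub1S (fun j => (r j)%:Z)).
  by have := vr (Ordinal n1); rewrite leqn0 => /eqP->.
have mmE i : (1 <= i < n)%N -> sub1 x i = mm x i - mm x i.+1.
  by move=> /andP[_ ltin]; rewrite mm_diff.
congr lmono.
  rewrite [X in _ = _ * X](eq_big_nat _ _ (F2 := fun i => uu i ^ (mm x i - mm x i.+1))); last first.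
    by move=> i /mmE xi; rewrite xi.
  rewrite -(weight_split n_gt0 (mm_last x) a_unit r1); apply: eq_big_nat => i /andP[_ ltin].
  congr (_ ^ (_ - _)); last by rewrite /= recombineE.
  by case: i ltin => // i ltin; rewrite /= recombineE //= ltnW.
rewrite [X in _ = _ + X](eq_big_nat _ _ (F2 := fun i =>
    ex r i * (mm x i - mm x i.+1) + (i * i.+1)%:Z * tri (mm x i - mm x i.+1))); last first.
  by move=> i /mmE xi; rewrite xi.
rewrite -(quad_split _ n_gt0 (mm_last x)); apply: eq_big_nat => i /andP[i0 ltin].
by rewrite !recombineE ?ltin ?i0 ?(ltnW ltin).
Qed.

Let triple r i : laurent K :=
  qpoch ('q ^+ (i * i.+1)) ('q ^+ (i * i.+1)) *
  qpoch (- (\prod_(0 <= l < i) ((a i)%:L / (a l)%:L)) *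
         'q ^ ((i * i.+1)./2%:Z + i.+1%:Z * rr r i - i%:Z * rr r i.+1))
        ('q ^+ (i * i.+1)) *
  qpoch (- (\prod_(0 <= l < i) ((a l)%:L / (a i)%:L)) *
         'q ^ ((i * i.+1)./2%:Z - i.+1%:Z * rr r i + i%:Z * rr r i.+1))
        ('q ^+ (i * i.+1)).

Let tripleE r i : (0 < i < n)%N ->
  triple r i = lsum (jterm (i * i.+1) (uu i) (ex r i)).
Proof.
move=> /andP[i0 ltin]; have N0 : (0 < i * i.+1)%N by rewrite muln_gt0 i0.
have uU := ratio_unit a_unit ltin; rewrite -/(uu i) in uU.
have divL (x y : K) : y \is a GRing.unit -> x%:L / y%:L = (x / y)%:L :> laurent K.
  by move=> yU; rewrite rmorphM /= rmorphV.
have alU l : (l < i)%N -> a l \is a GRing.unit.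
  by move=> li; apply: a_unit; exact: ltn_trans ltin.
rewrite -(jacobi_triple N0 (ex r i) uU) /triple.
have -> : \prod_(0 <= l < i) ((a i)%:L / (a l)%:L) = (uu i)%:L :> laurent K.
  rewrite /uu rmorph_prod; apply: eq_big_nat => l /andP[_ li].
  by rewrite divL// alU.
have -> : \prod_(0 <= l < i) ((a l)%:L / (a i)%:L) = (uu i)^-1%:L :> laurent K.
  rewrite /uu !big_nat -prodrV => [|l /andP[_ li]]; last first.
    by rewrite unitrM unitrV !a_unit//; exact: ltn_trans ltin.
  rewrite rmorph_prod; apply: eq_bigr => l /andP[_ li].
  have [iU lU] := (a_unit ltin, alU l li).
  by rewrite divL//= invrM ?unitrV// invrK.
(* The exponents of q in the two symbols must add up to i(i+1), as Jacobi's identity requires. *)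
have -> : (i * i.+1)./2%:Z - i.+1%:Z * rr r i + i%:Z * rr r i.+1 =
    (i * i.+1)%:Z - ex r i.
  have := half_mulS i; rewrite /ex PoszM intS; move: (_./2)%:Z => h hE.
  suff -> : i%:Z * (1 + i%:Z) = h * 2 by ring.
  by rewrite hE addrC.
by rewrite -/(ex r i) !mulNr !lqXz /lconst !lmonoM !mulr1 !add0r.
Qed.

(** For each residue vector the sum over x factors into n - 1 independent theta series, and each is
    a triple product. *)
Lemma theta_product : lsum (@theta_term K n a) =
  \prod_(1 <= i < n) qpoch ('q ^+ (i * i.+1)) ('q ^+ (i * i.+1)) *
  \sum_(r : rvec | [forall j, (r j <= j)%N])
    let r_ := sub1 (fun j => (r j)%:Z) in
    \prod_(1 <= i < n)
      ((a i)%:L ^ (r_ i - r_ i.+1) * 'q ^ (r_ i * (r_ i - r_ i.+1)) *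
       qpoch (- (\prod_(0 <= l < i) ((a i)%:L / (a l)%:L)) *
              'q ^ ((i * i.+1)./2%:Z + i.+1%:Z * r_ i - i%:Z * r_ i.+1))
             ('q ^+ (i * i.+1)) *
       qpoch (- (\prod_(0 <= l < i) ((a l)%:L / (a i)%:L)) *
              'q ^ ((i * i.+1)./2%:Z - i.+1%:Z * r_ i + i%:Z * r_ i.+1))
             ('q ^+ (i * i.+1))).
Proof.
rewrite (lsum_residue (lsmall_theta n_gt0 a_unit)); rewrite mulr_sumr; apply: eq_bigr => r vr.
transitivity (head r * \prod_(1 <= i < n) triple r i); last first.
  rewrite /head /triple -!big_split /=; apply: eq_bigr => i _; rewrite -/(rr r).
  move: (qpoch _ _) (qpoch _ _) (qpoch _ _) (_ ^ _) (_ ^ _) => Q1 Q2 Q3 c d.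
  ring.
under eq_lsum do rewrite theta_term_recombine//.
pose J (j : 'I_n.-1) := jterm (j.+1 * j.+2) (uu j.+1) (ex r j.+1).
have Js j : lsmall (J j).
  by apply: lsmall_jterm => //; apply: (ratio_unit a_unit); have := ltn_ord j; lia.
have [Jps JpE] := lprod_lsum Js.
have prodE (x : zvec) : \prod_(1 <= i < n) jterm (i * i.+1) (uu i) (ex r i) (sub1 x i) =
    \prod_(j < n.-1) J j (x j).
  rewrite big_add1 big_mkord; apply: eq_bigr => j _.
  by rewrite sub1S.
under eq_lsum do rewrite prodE.
rewrite lsumZ// -JpE big_add1 big_mkord; congr (_ * _); apply: eq_bigr => j _.
by rewrite tripleE//; have := ltn_ord j; lia.
Qed.

End SecondFormula.

Theorem theorem1p31 (K : comUnitRingType) (n : nat) (a : nat -> K)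
    (n_gt0 : (0 < n)%N)
    (a_unit : forall i : nat, (i < n)%N -> a i \is a GRing.unit)
    (G : laurent K)
    (G_def : G = colour_series a (@Pcount n) \/ G = colour_series a (@Fcount n)) :
  G = (qpoch 'q 'q ^+ n)^-1 *
      lsum (fun s : {ffun 'I_n.-1 -> int} =>
        (a 0%N)%:L ^ (- sub1 s 1%N) *
        \prod_(1 <= i < n) ((a i)%:L ^ (sub1 s i - sub1 s i.+1) *
                            'q ^ (sub1 s i * (sub1 s i - sub1 s i.+1))))
  /\
  G = (qpoch 'q 'q)^-1 *
      (\prod_(1 <= i < n)
         (qpoch ('q ^+ (i * i.+1)) ('q ^+ (i * i.+1)) / qpoch 'q 'q)) *
      \sum_(r : {ffun 'I_n.-1 -> 'I_n} | [forall j, (r j <= j)%N])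
        let r_ := sub1 (fun j => (r j)%:Z) in
        \prod_(1 <= i < n)
          ((a i)%:L ^ (r_ i - r_ i.+1) * 'q ^ (r_ i * (r_ i - r_ i.+1)) *
           qpoch (- (\prod_(0 <= l < i) ((a i)%:L / (a l)%:L)) *
                  'q ^ ((i * i.+1)./2%:Z + i.+1%:Z * r_ i - i%:Z * r_ i.+1))
                 ('q ^+ (i * i.+1)) *
           qpoch (- (\prod_(0 <= l < i) ((a l)%:L / (a i)%:L)) *
                  'q ^ ((i * i.+1)./2%:Z - i.+1%:Z * r_ i + i%:Z * r_ i.+1))
                 ('q ^+ (i * i.+1))).
Proof.
have {G_def} -> : G = colour_series a (@Fcount n).
  by case: G_def => // ->; exact: Pseries_Fseries.
split; first exact: (Fseries_thetaE n_gt0 a_unit).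
rewrite (Fseries_thetaE n_gt0 a_unit) (theta_product n_gt0 a_unit) mulrA.
(* The n - 1 denominators in the product and the leading one make up the n-th power of (q;q)_oo. *)
congr (_ * _); rewrite big_split /= mulrCA mulrC -exprVn; congr (_ * _).
have [m ->] : exists m, n = m.+1 by exists n.-1; rewrite prednK.
by rewrite exprS prodr_const_nat subn1.
Qed.
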